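(* Assume the following. (1) There are a constant $\Delta>0$ and a measurable function $b:\mathbb{R}^m\to\mathbb{R}_+$ such that $\langle H(\theta,y),\theta\rangle\ge \Delta|\theta|^2-b(y)$ for all $\theta\in\mathbb{R}^d$, $y\in\mathbb{R}^m$. (2) There are constants $K_1,K_2,K_3>0$ and $\beta\ge 1$ such that $|H(\theta,y)|\le K_1|\theta|+K_2|y|^{\beta}+K_3$ for all $\theta\in\mathbb{R}^d$, $y\in\mathbb{R}^m$. (3) There are finite constants $M_y,M_b>0$ such that $\mathbb{E}[|Y_0|^{2\beta}]\le M_y$ and $\mathbb{E}[b(Y_0)]\le M_b$. Then there is $\lambda_0\in(0,1]$ such that for every $\lambda\in(0,\lambda_0)$ there exists a probability measure $\mu_\lambda$ on $\mathscr{B}(\mathbb{R}^d)$ such that for every deterministic initial value $\theta_0\in\mathbb{R}^d$, the law $\mathscr{L}(\theta_t^\lambda)$ of the process defined by $$\theta_{t+1}^\lambda=\theta_t^\lambda-\lambda H(\theta_t^\lambda,Y_t)+\sqrt{\lambda}\,\xi_{t+1},\quad t\in\mathbb{N},\qquad \theta_0^\lambda=\theta_0,$$ converges to $\mu_\lambda$ in total variation as $t\to\infty$. That is, the law converges in total variation and the limit does not depend on the initialization $\theta_0$.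
   Context: Let $d,m\ge1$ be integers, and let all random variables be defined on a probability space $(\Omega,\mathcal{F},\mathbb{P})$. $\mathbb{N}=\{0,1,2,\dots\}$, $|\cdot|$ is the Euclidean norm, $\mathscr{L}(X)$ is the law of $X$, and $\mathscr{B}(\cdot)$ denotes the Borel $\sigma$-algebra. The sequence $(\xi_i)_{i\ge1}$ is i.i.d. with values in $\mathbb{R}^d$; each $\xi_i$ has independent coordinates, $\mathbb{E}[\xi_i]=0$, $\mathbb{E}[|\xi_i|^2]=\sigma^2<\infty$, and has a density $f$ with respect to $d$-dimensional Lebesgue measure such that $\inf_{x\in K}f(x)>0$ for every compact $K\subset\mathbb{R}^d$. The process $(Y_t)_{t\in\mathbb{Z}}$ is a strict-sense stationary process with values in $\mathbb{R}^m$, independent of $(\xi_i)_{i\ge1}$. The function $H:\mathbb{R}^d\times\mathbb{R}^m\to\mathbb{R}^d$ is measurable. *)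

(* Defs.v *)
From HB Require Import structures.
From mathcomp Require Import all_boot all_order all_algebra finmap.
From mathcomp Require Import all_classical all_reals all_analysis.
From mathcomp Require Import measurable_realfun.

Set Implicit Arguments.
Unset Strict Implicit.
Unset Printing Implicit Defensive.

Import Order.TTheory GRing.Theory Num.Theory.
Import numFieldNormedType.Exports.

Local Open Scope classical_set_scope.
Local Open Scope ring_scope.

Section borel_rV.
Context (R : realType) (n : nat).

Definition borel_rV : set (set 'rV[R]_n) := <<s [set U | open U] >>.

Let borel_rV0 : borel_rV set0.
Proof. exact: sigma_algebra0. Qed.

Let borel_rVC A : borel_rV A -> borel_rV (~` A).
Proof. exact: sigma_algebraC. Qed.

Let borel_rV_bigcup (F : (set 'rV[R]_n)^nat) :
  (forall i, borel_rV (F i)) -> borel_rV (\bigcup_i F i).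
Proof. exact: sigma_algebra_bigcup. Qed.

HB.instance Definition _ := @isMeasurable.Build default_measure_display
  'rV[R]_n borel_rV borel_rV0 borel_rVC borel_rV_bigcup.

End borel_rV.

Section measurable_rV.
Context (R : realType) (n : nat).

Lemma measurable_coord (i : 'I_n) :
  measurable_fun [set: 'rV[R]_n] (fun v : 'rV[R]_n => v ord0 i).
Proof.
apply: (measurability _ (RGenOpens.measurableE R)).
move=> _ [_ [a [b ->] <-]]; rewrite setTI.
apply: sub_sigma_algebra => /=; apply: open_comp => [v _|].
  exact: coord_continuous.
exact: interval_open.
Qed.

Lemma measurable_fun_rV d (T : measurableType d) (f : T -> 'rV[R]_n) :
  (forall i, measurable_fun setT (fun x => f x ord0 i)) -> measurable_fun setT f.
Proof.
move=> mf.
have mball (q : 'rV[R]_n) e : 0 < e -> measurable (f @^-1` ball q e).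
  move=> e0.
  rewrite (_ : _ @^-1` _ = \bigcap_(i in [set: 'I_n])
      ((fun x => f x ord0 i) @^-1` ball (q ord0 i) e)); last first.
    apply/seteqP; split=> [x /= [_ fx] i _|x fx]; first exact: fx.
    by split=> // j i; rewrite !ord1; exact: fx.
  apply: fin_bigcap_measurable => // i _; rewrite -[X in measurable X]setTI.
  by apply: mf => //; apply: open_measurable; exact: ball_open.
apply: (@measurability _ _ _ _ _ _ [set U : set 'rV[R]_n | open U]) => //.
move=> _ [U oU <-]; rewrite setTI.
pose B (p : 'rV[rat]_n * nat) := ball (map_mx ratr p.1 : 'rV[R]_n) p.2.+1%:R^-1.
rewrite (_ : U = \bigcup_(p in [set p | B p `<=` U]) B p); last first.
  apply/seteqP; split=> [x Ux|x [p Dp]]; last exact: Dp.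
  have /nbhs_ballP[e /= e0 xeU] : nbhs x U by exact: open_nbhs_nbhs.
  have [k k_gt] : exists k : nat, (k.+1%:R^-1 : R) < e / 2.
    have [k _ /(_ k (leqnn k))] :=
      near_infty_natSinv_lt (PosNum (divr_gt0 e0 (ltr0Sn R 1))).
    by exists k.
  have k0 : 0 < (k.+1%:R^-1 : R) by rewrite invr_gt0 ltr0Sn.
  have /choice[q qx] : forall i : 'I_n, exists q : rat,
      ball (x ord0 i) k.+1%:R^-1 (ratr q).
    move=> i; have /rat_in_itvoo[q] :
        x ord0 i - k.+1%:R^-1 < x ord0 i + k.+1%:R^-1.
      by rewrite ltrD2l gtrN.
    by exists q; rewrite ball_itv.
  have xq : ball x k.+1%:R^-1 (map_mx ratr (\row_i q i) : 'rV[R]_n).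
    by split=> // i j; rewrite !mxE !ord1.
  exists (\row_i q i, k); last exact: ball_sym.
  move=> y /= qy; apply: xeU.
  apply: (@le_ball _ _ _ (k.+1%:R^-1 + k.+1%:R^-1)).
    by rewrite [leRHS]splitr lerD// ltW.
  exact: ball_triangle xq qy.
rewrite preimage_bigcup bigcup_mkcond.
apply: countable_bigcupT_measurable => [|p]; first exact: countableP.
by case: ifPn => // _; apply: mball; rewrite invr_gt0 ltr0Sn.
Qed.

End measurable_rV.

(* Lebesgue measure on R^n, as the n-fold product of [lebesgue_measure]. *)
Section lebesgue_rV.
Context (R : realType).

Definition consrV n (p : R * 'rV[R]_n) : 'rV[R]_n.+1 :=
  row_mx (p.1%:M : 'rV_1) p.2.

Definition unconsrV n (v : 'rV[R]_n.+1) : R * 'rV[R]_n :=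
  (v ord0 ord0, \row_i v ord0 (lift ord0 i)).

Lemma consrV0 n p : @consrV n p ord0 ord0 = p.1.
Proof.
by rewrite /consrV mxE; case: splitP => // i _; rewrite [i]ord1 mxE mulr1n.
Qed.

Lemma consrVS n p i : @consrV n p ord0 (lift ord0 i) = p.2 ord0 i.
Proof.
rewrite /consrV mxE; case: splitP => [j|j /= /eqP].
  by rewrite ord1.
by rewrite eqSS => /eqP/val_inj ->.
Qed.

Lemma consrVK n : cancel (@consrV n) (@unconsrV n).
Proof.
move=> [x v]; rewrite /unconsrV consrV0; congr pair.
by apply/rowP => i; rewrite mxE consrVS.
Qed.

Lemma measurable_consrV n : measurable_fun setT (@consrV n).
Proof.
apply: measurable_fun_rV => i; case: (unliftP ord0 i) => [j|] ->.
  rewrite (_ : (fun _ => _) = (fun v : 'rV[R]_n => v ord0 j) \o snd).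
    by apply: measurableT_comp => //; exact: measurable_coord.
  by apply/funext => p; rewrite consrVS.
rewrite (_ : (fun _ => _) = fst)//.
by apply/funext => p; rewrite consrV0.
Qed.

Lemma measurable_unconsrV n : measurable_fun setT (@unconsrV n).
Proof.
apply: measurable_fun_pair; first exact: measurable_coord.
apply: measurable_fun_rV => i; under eq_fun do rewrite mxE.
exact: measurable_coord.
Qed.

Definition lebesgue_rVS n (mu : {sigma_finite_measure set 'rV[R]_n -> \bar R}) :
    set 'rV[R]_n.+1 -> \bar R :=
  pushforward (lebesgue_measure \x mu)%E (@consrV n).

Section lebesgue_rVS_measure.
Context n (mu : {sigma_finite_measure set 'rV[R]_n -> \bar R}).

Let lebesgue_rVS0 : lebesgue_rVS mu set0 = 0%E.
Proof. by rewrite /lebesgue_rVS /pushforward preimage_set0 measure0. Qed.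

Let lebesgue_rVS_ge0 A : (0 <= lebesgue_rVS mu A)%E.
Proof. by rewrite /lebesgue_rVS /pushforward; exact: measure_ge0. Qed.

Let lebesgue_rVS_sigma_additive : semi_sigma_additive (lebesgue_rVS mu).
Proof.
have mcons A : measurable A -> measurable (@consrV n @^-1` A).
  by move=> mA; rewrite -[X in measurable X]setTI; exact: measurable_consrV.
move=> F mF tF mUF; rewrite /lebesgue_rVS /pushforward preimage_bigcup.
apply: measure_semi_sigma_additive; first by move=> k; exact: mcons.
  apply/trivIsetP => i j _ _ ij; rewrite -preimage_setI.
  by move/trivIsetP : tF => ->//; rewrite preimage_set0.
by rewrite -preimage_bigcup; exact: mcons.
Qed.

HB.instance Definition _ := isMeasure.Build _ _ _ (lebesgue_rVS mu)
  lebesgue_rVS0 lebesgue_rVS_ge0 lebesgue_rVS_sigma_additive.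

Let lebesgue_rVS_sigma_finite : sigma_finite setT (lebesgue_rVS mu).
Proof.
have /sigma_finiteP[F [FT ndF Foo]] :=
  sigma_finiteT (@lebesgue_measure R : {sigma_finite_measure set _ -> \bar R}).
have /sigma_finiteP[G [GT ndG Goo]] := sigma_finiteT mu.
exists (fun k => @unconsrV n @^-1` (F k `*` G k)).
  rewrite -preimage_bigcup; apply/esym; rewrite -subTset => v _ /=.
  have [i _ Fi] : (\bigcup_i F i) (unconsrV v).1 by rewrite -FT.
  have [j _ Gj] : (\bigcup_i G i) (unconsrV v).2 by rewrite -GT.
  exists (maxn i j) => //; split.
  - by move: Fi; exact/subsetPset/ndF/leq_maxl.
  - by move: Gj; exact/subsetPset/ndG/leq_maxr.
move=> k; have [mF Fk] := Foo k; have [mG Gk] := Goo k; split.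
  rewrite -[X in measurable X]setTI; apply: measurable_unconsrV => //.
  exact: measurableX.
rewrite /lebesgue_rVS /pushforward -comp_preimage.
rewrite (_ : _ \o _ = id); last by apply/funext => p /=; rewrite consrVK.
by rewrite preimage_id product_measure1E// lte_mul_pinfty// ge0_fin_numE.
Qed.

HB.instance Definition _ := Measure_isSigmaFinite.Build _ _ _
  (lebesgue_rVS mu) lebesgue_rVS_sigma_finite.

End lebesgue_rVS_measure.

Fixpoint lebesgue_rV n : {sigma_finite_measure set 'rV[R]_n -> \bar R} :=
  if n is n.+1 then lebesgue_rVS (lebesgue_rV n) else dirac (0 : 'rV[R]_0).

Lemma lebesgue_rV_box n (a b : 'I_n -> R) : (forall i, a i <= b i) ->
  lebesgue_rV n [set v : 'rV[R]_n | forall i, v ord0 i \in `]a i, b i]] =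
  (\prod_i (b i - a i))%:E.
Proof.
elim: n a b => [|n IH] a b ab.
  by rewrite big_ord0 /= diracE mem_set//= => -[].
have mbox m (u v : 'I_m -> R) :
    measurable [set x : 'rV[R]_m | forall i, x ord0 i \in `]u i, v i]].
  rewrite (_ : [set _ | _] = \bigcap_(i in [set: 'I_m])
      (fun x : 'rV[R]_m => x ord0 i) @^-1` `]u i, v i]%classic); last first.
    by apply/seteqP; split=> [x h i _|x h i]; [exact: h|exact: h].
  apply: fin_bigcap_measurable => // i _; rewrite -[X in measurable X]setTI.
  by apply: measurable_coord.
transitivity ((lebesgue_measure \x lebesgue_rV n)%E
  (`]a ord0, b ord0]%classic `*`
   [set v : 'rV[R]_n | forall i, v ord0 i \in `]a (lift ord0 i), b (lift ord0 i)]])).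
  rewrite /= /lebesgue_rVS /pushforward; congr product_measure1.
  apply/seteqP; split=> [p /= pab|p /= [p0 pS] i].
    split; first by have := pab ord0; rewrite consrV0.
    by move=> i; have := pab (lift ord0 i); rewrite consrVS.
  by case: (unliftP ord0 i) => [j|] ->; rewrite ?consrVS ?consrV0.
rewrite product_measure1E//; last exact: mbox.
rewrite big_ord_recl EFinM IH//; congr (_ * _)%E.
apply: (etrans (lebesgue_measure_itv `]a ord0, b ord0])).
rewrite /= lte_fin; case: ltgtP (ab ord0) => // -> _.
by rewrite subrr.
Qed.

End lebesgue_rV.

Section euclidean.
Context (R : realType) (n : nat).
Implicit Types u v : 'rV[R]_n.

Definition dotp u v : R := \sum_i u ord0 i * v ord0 i.

(* The library's norm on ['rV[R]_n] is the max norm. *)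
Definition enorm v : R := Num.sqrt (dotp v v).

End euclidean.

Section probability_notions.
Context d (Omega : measurableType d) (R : realType) (P : probability Omega R).
Context d' (T : measurableType d').

Definition mutually_independent (I : choiceType) (D : set I)
    (X : I -> Omega -> T) :=
  forall (J : {fset I}) (A : I -> set T),
    [set` J] `<=` D -> (forall i, i \in J -> measurable (A i)) ->
    P (\bigcap_(i in [set` J]) X i @^-1` A i) =
    (\prod_(i <- J) P (X i @^-1` A i))%E.

Definition identically_distributed (I : Type) (D : set I) (X : I -> Omega -> T) :=
  forall i j (A : set T), D i -> D j -> measurable A ->
    P (X i @^-1` A) = P (X j @^-1` A).

Definition has_density (X : Omega -> T) (mu : {measure set T -> \bar R})
    (f : T -> R) :=
  [/\ measurable_fun setT f, forall x, 0 <= f x &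
      forall A, measurable A ->
        P (X @^-1` A) = (\int[mu]_(x in A) (f x)%:E)%E].

Definition strictly_stationary (X : int -> Omega -> T) :=
  forall (n : nat) (t : 'I_n -> int) (s : int) (A : set (n.-tuple T)),
    measurable A ->
    P [set w | A [tuple X (t i + s) w | i < n]] =
    P [set w | A [tuple X (t i) w | i < n]].

Definition sigma_generated (I : Type) (D : set I) (X : I -> Omega -> T) :
    set (set Omega) :=
  <<s \bigcup_(i in D) preimage_set_system setT (X i) measurable >>.

End probability_notions.

Definition independent_systems d (Omega : measurableType d) (R : realType)
    (P : probability Omega R) (F G : set (set Omega)) :=
  forall A B, F A -> G B -> P (A `&` B) = (P A * P B)%E.

Definition tv_dist d (T : measurableType d) (R : realType)
    (mu nu : set T -> \bar R) : \bar R :=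
  ereal_sup [set `|mu A - nu A|%E | A in measurable].

Fixpoint theta_process (R : realType) (d m : nat) (Omega : Type)
    (H : 'rV[R]_d * 'rV[R]_m -> 'rV[R]_d) (xi : nat -> Omega -> 'rV[R]_d)
    (Y : int -> Omega -> 'rV[R]_m) (lambda : R) (theta0 : 'rV[R]_d) (t : nat) :
    Omega -> 'rV[R]_d :=
  if t is t.+1 then
    let th := theta_process H xi Y lambda theta0 t in
    fun w => th w - lambda *: H (th w, Y t%:Z w) + Num.sqrt lambda *: xi t.+1 w
  else cst theta0.

(* Main.v *)
Require Import Defs.
From HB Require Import structures.
From mathcomp Require Import all_boot all_order all_algebra finmap.
From mathcomp Require Import all_classical all_reals all_analysis.
From mathcomp Require Import measurable_realfun ring lra.

Set Implicit Arguments.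
Unset Strict Implicit.
Unset Printing Implicit Defensive.

Import Order.TTheory GRing.Theory Num.Theory.
Import numFieldNormedType.Exports.

Local Open Scope classical_set_scope.
Local Open Scope ring_scope.

(* Work with the joint laws of (theta_t, environment) instead of quenched laws.
   At a time t where |theta_t|^2 and |Y_t|^(2 beta) are at most r, the transition
   kernel dominates alpha times the uniform law on the unit cube, with
   alpha = alpha(r) > 0, because the noise density is bounded below on compacts.
   By dissipativity E|theta_t|^2 is bounded uniformly in t, hence for each chain
   the bad event has probability at most eps for r large.  If u_t bounds the
   total variation distance of the joint laws of two chains driven by the same
   environment, then u_(t+1) <= (1 - alpha) u_t + alpha eps is again a bound,
   hence limsup u_t <= eps; neither ergodicity nor mixing of Y is needed.
   One of the two chains may have been started s steps earlier; by stationarity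
   of Y its law at time t is the law of theta_(t+s).  So the laws are Cauchy in
   total variation, uniformly in s, with a limit that does not depend on the
   initial value. *)

(** * Lebesgue measure and affine maps; minorization *)

Lemma measurable_preimageT d1 d2 (T1 : measurableType d1)
    (T2 : measurableType d2) (f : T1 -> T2) (A : set T2) :
  measurable_fun setT f -> measurable A -> measurable (f @^-1` A).
Proof. by move=> mf mA; rewrite -[X in measurable X]setTI; exact: mf. Qed.

Section affine.
Context (R : realType).

Lemma measurable_affine (a c : R) : measurable_fun setT (fun x : R => a + c * x).
Proof. by apply: measurable_funD => //; exact: measurable_funM. Qed.

(** Scaling by [c] the image of Lebesgue measure under the affine map gives the right mass to every
    half-open interval, and such a measure is unique. *)
Lemma lebesgue_measure_affine (a c : R) (A : set R) : 0 < c -> measurable A ->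
  lebesgue_measure ((fun x : R => a + c * x) @^-1` A) =
  (c^-1%:E * lebesgue_measure A)%E.
Proof.
move=> c0 mA; pose phi (x : measurableTypeR R) : measurableTypeR R := a + c * x.
have mphi : measurable_fun setT phi by exact: measurable_affine.
pose ci : {nonneg R} := NngNum (ltW c0).
rewrite (@lebesgue_measure_unique R
  (mscale ci (pushforward lebesgue_measure phi)) _ A)//.
- rewrite /= /mscale /= muleA -EFinM mulVf ?mul1e ?gt_eqF//.
- move=> _ [[u v]] _ <- /=; rewrite /mscale /= /pushforward.
  rewrite (_ : phi @^-1` _ = `](u - a) / c, (v - a) / c]%classic); last first.
    apply/seteqP; split => x /=; rewrite !in_itv/= /phi.
      by rewrite ltr_pdivrMr// ler_pdivlMr// mulrC; lra.
    by rewrite ltr_pdivrMr// ler_pdivlMr// mulrC; lra.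
  rewrite !lebesgue_measure_itv/= !lte_fin.
  rewrite ltr_pM2r ?invr_gt0// ltrD2r; case: ifPn => _; last by rewrite mule0.
  by rewrite -EFinB -EFinM; congr EFin; field; rewrite gt_eqF.
Qed.

Lemma ge0_integral_affine (a c : R) (g : R -> \bar R) : 0 < c ->
  measurable_fun setT g -> (forall x, 0 <= g x)%E ->
  (\int[lebesgue_measure]_x g (a + c * x)%R =
   c^-1%:E * \int[lebesgue_measure]_x g x)%E.
Proof.
move=> c0 mg g0.
have c0' : 0 <= c^-1 by rewrite invr_ge0 ltW.
pose ci : {nonneg R} := NngNum c0'.
rewrite -[in RHS](@ge0_integral_mscale _ (measurableTypeR R) R
  lebesgue_measure setT _ ci)//.
rewrite -[LHS](@ge0_integral_pushforward _ _ _ _ _ _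
  (measurable_affine a c :
    @measurable_fun _ _ (measurableTypeR R) (measurableTypeR R) _ _)
  lebesgue_measure setT g)//.
apply: eq_measure_integral => [|? B mB _]; first exact: measurable_affine.
rewrite /pushforward /= /mscale /=; exact: lebesgue_measure_affine.
Qed.

(** Induction on the dimension: the section at [x] of the preimage is the preimage, under the affine
    map of the remaining coordinates, of the section at [a ord0 ord0 + c * x]. Each coordinate
    contributes one factor [c^-1]. *)
Lemma lebesgue_rV_affine n (a : 'rV[R]_n) (c : R) (A : set 'rV[R]_n) :
  0 < c -> measurable A ->
  lebesgue_rV R n ((fun x => a + c *: x) @^-1` A) =
  ((c^-1 ^+ n)%:E * lebesgue_rV R n A)%E.
Proof.
move=> c0; elim: n a A => [|n IH] a A mA.
  rewrite expr0 mul1e /= !diracE; congr (_ %:R%:E); congr nat_of_bool.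
  by apply/idP/idP; rewrite !inE; rewrite /preimage /= (_ : a + _ = 0)//;
    apply/rowP => -[].
pose a' : 'rV[R]_n := \row_i a ord0 (lift ord0 i).
have mcA : measurable (@consrV R n @^-1` A).
  exact: measurable_preimageT (@measurable_consrV R n) mA.
pose g x := lebesgue_rV R n (xsection (@consrV R n @^-1` A) x).
have mg : measurable_fun setT g by exact: measurable_fun_xsection.
transitivity (\int[lebesgue_measure]_x ((c^-1 ^+ n)%:E * g (a ord0 ord0 + c * x)%R))%E.
  rewrite /= /lebesgue_rVS /pushforward /product_measure1 /=.
  apply: eq_integral => x _; rewrite -(IH a'); last exact: measurable_xsection.
  congr (lebesgue_rV R n _); apply/seteqP.
  have cons_affine v : a + c *: consrV (x, v) =
      consrV (a ord0 ord0 + c * x, a' + c *: v).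
    apply/rowP => i; rewrite [LHS]mxE [X in _ + X]mxE.
    by case: (unliftP ord0 i) => [j|] ->; rewrite ?consrVS ?consrV0 //= !mxE.
  by split=> v; rewrite /xsection/= !inE /= cons_affine.
rewrite ge0_integralZl//; last 2 first.
- exact: (measurableT_comp mg (measurable_affine _ _)).
- by rewrite lee_fin exprn_ge0// invr_ge0 ltW.
by rewrite ge0_integral_affine// muleA -EFinM exprSr.
Qed.

(** The sides are half-open to match [lebesgue_rV_box], which gives the cube mass one. *)
Definition unit_cube (n : nat) : set 'rV[R]_n :=
  [set v | forall i, v ord0 i \in `]0, 1]].

Lemma measurable_unit_cube n : measurable (@unit_cube n).
Proof.
rewrite (_ : @unit_cube n = \bigcap_(i in [set: 'I_n])
    (fun x : 'rV[R]_n => x ord0 i) @^-1` `]0, 1]%classic); last first.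
  by apply/seteqP; split=> [x h i _|x h i]; [exact: h|exact: h].
apply: fin_bigcap_measurable => // i _.
by apply: measurable_preimageT => //; exact: measurable_coord.
Qed.

Definition uniform_cube (n : nat) : set 'rV[R]_n -> \bar R :=
  mrestr (lebesgue_rV R n) (@measurable_unit_cube n).

HB.instance Definition _ n := Measure.on (@uniform_cube n).

Let uniform_cubeT n : @uniform_cube n setT = 1%E.
Proof.
rewrite /uniform_cube /= /mrestr setTI.
rewrite (@lebesgue_rV_box R n (fun=> 0) (fun=> 1))//.
by rewrite subr0 prodr_const expr1n.
Qed.

HB.instance Definition _ n :=
  Measure_isProbability.Build _ _ _ (@uniform_cube n) (@uniform_cubeT n).

(** If [a + c *: x] lies in the unit cube and the coordinates of [a] are at most [rho] in absolute
    value, then [x] lies in a fixed compact box, where the density is at least some [k > 0]. The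
    affine change of variables turns this into a multiple [k * c^-1 ^+ n] of the uniform law. *)
Lemma density_minorization d (Omega : measurableType d) (P : probability Omega R)
    n (X : Omega -> 'rV[R]_n) (f : 'rV[R]_n -> R) (c rho : R) :
  has_density P X (lebesgue_rV R n) f ->
  (forall K, compact K -> 0 < ereal_inf [set (f x)%:E | x in K])%E ->
  0 < c ->
  exists alpha, [/\ 0 < alpha, alpha < 1 &
    forall (a : 'rV[R]_n) (A : set 'rV[R]_n),
      (forall i, `|a ord0 i| <= rho) -> measurable A ->
      (alpha%:E * @uniform_cube n A <= P [set w | A (a + c *: X w)%R])%E].
Proof.
move=> [mf f0 Xf] finf c0.
(* Half-width of that box; the absolute value keeps [r] nonnegative for every real [rho]. *)
pose r := (1 + `|rho|) / c.
have r0 : 0 <= r by rewrite divr_ge0 ?addr_ge0// ltW.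
pose K : set 'rV[R]_n := [set v | forall i, `[- r, r]%classic (v ord0 i)].
have /finf : compact K.
  apply: (@rV_compact R n (fun=> `[- r, r]%classic)) => i.
  exact: segment_compact.
set e := ereal_inf _ => e0.
have fe x : K x -> (e <= (f x)%:E)%E by move=> Kx; apply: ereal_inf_lbound; exists x.
have K0 : K 0 by move=> i; rewrite /= mxE in_itv/= oppr_le0 r0.
have efin : e \is a fin_num.
  by rewrite ge0_fin_numE ?ltW//; apply: le_lt_trans (fe _ K0) _; rewrite ltry.
pose k := fine e.
have k0 : 0 < k by rewrite /k fine_gt0// e0 -ge0_fin_numE ?ltW.
(* The minimum with one half only serves to make [alpha < 1]. *)
pose alpha := Num.min (k * c^-1 ^+ n) 2^-1.
exists alpha; split.
- by rewrite /alpha lt_min !mulr_gt0 ?exprn_gt0 ?invr_gt0 ?ltr0n.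
- by rewrite /alpha gt_min; apply/orP; right; lra.
move=> a A arho mA.
pose phi (x : 'rV[R]_n) := a + c *: x.
have mphi : measurable_fun setT phi.
  apply: measurable_fun_rV => i; rewrite /phi; under eq_fun do rewrite !mxE.
  by apply: measurable_funD => //; apply: measurable_funM => //; exact: measurable_coord.
have mAC : measurable (A `&` @unit_cube n).
  by apply: measurableI => //; exact: measurable_unit_cube.
rewrite (_ : [set w | _] = X @^-1` (phi @^-1` A))// Xf; last exact: measurable_preimageT.
apply: (@le_trans _ _ ((k * c^-1 ^+ n)%:E * @uniform_cube n A)%E).
  by rewrite lee_wpmul2r// lee_fin /alpha ge_min lexx.
rewrite /uniform_cube /mrestr EFinM -muleA -(lebesgue_rV_affine a)// -/phi.
apply: (@le_trans _ _ (\int[lebesgue_rV R n]_(x in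
    phi @^-1` (A `&` @unit_cube n)) (f x)%:E)%E).
  rewrite -integral_cst//; last exact: measurable_preimageT.
  apply: ge0_le_integral => //.
  - exact: measurable_preimageT.
  - by move=> x _; rewrite lee_fin ltW.
  - by apply/measurable_EFinP; apply: measurable_funTS.
  move=> x /= [_ Cx].
  rewrite -[leRHS]/((f x)%:E) /k fineK//; apply: fe => i; rewrite /= in_itv /= -ler_norml.
  rewrite /r ler_pdivlMr// -[X in _ * X](gtr0_norm c0) -normrM.
  have := Cx i; rewrite /phi !mxE in_itv/= => /andP[Cx0 Cx1].
  have ai := arho i; have := ler_norm rho.
  have := ler_norm (a ord0 i); have := ler_norm (- a ord0 i); rewrite normrN.
  by rewrite ler_norml; lra.
apply: ge0_subset_integral => //.
- exact: measurable_preimageT.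
- exact: measurable_preimageT.
- by apply/measurable_EFinP; apply: measurable_funTS.
- by move=> x _; rewrite lee_fin.
- by move=> x [].
Qed.

End affine.

(** * Contraction under a minorization *)

Section contraction.
Context d (Z : measurableType d) (R : realType).

Lemma bounded_integrable (M : probability Z R) (g : Z -> R) (k : R) :
  measurable_fun setT g -> (forall z, `|g z| <= k) ->
  M.-integrable setT (EFin \o g).
Proof.
move=> mg gk; apply: measurable_bounded_integrable => //.
  by rewrite (le_lt_trans (probability_le1 M _))// ltry.
exists k; split; first exact: num_real.
by move=> x kx z _; apply: (le_trans (gk z)); exact: ltW.
Qed.

(* [h - alpha * c] takes values in [[0, 1 - alpha]] on [G], and the [c]-part has
   the same mean under both laws; clipping the difference to [[0, 1 - alpha]]
   costs at most [alpha] on the complement of [G]. *)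
Lemma minorized_contraction (M M' : probability Z R) (G : set Z) (h c : Z -> R)
    (alpha u e : R) :
  measurable G -> measurable_fun setT h -> measurable_fun setT c ->
  (forall z, 0 <= h z <= 1) -> (forall z, 0 <= c z <= 1) ->
  0 < alpha -> alpha < 1 ->
  (forall z, G z -> alpha * c z <= h z <= 1 - alpha + alpha * c z) ->
  \int[M]_z c z = \int[M']_z c z ->
  (M (~` G) + M' (~` G) <= e%:E)%E ->
  (forall g : Z -> R, measurable_fun setT g -> (forall z, 0 <= g z <= 1) ->
    `|\int[M]_z g z - \int[M']_z g z| <= u) ->
  `|\int[M]_z h z - \int[M']_z h z| <= (1 - alpha) * u + alpha * e.
Proof.
move=> mG mh mc h01 c01 a0 a1 Ghc cE Ge Hu.
pose k z := h z - alpha * c z.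
pose q z := Num.max 0 (Num.min (k z) (1 - alpha)).
have mk : measurable_fun setT k by apply: measurable_funB => //; exact: measurable_funM.
have mq : measurable_fun setT q by apply: measurable_maxr => //; exact: measurable_minr.
have q0 z : 0 <= q z by rewrite le_max lexx.
have q1 z : q z <= 1 - alpha by rewrite ge_max subr_ge0 ltW//= ge_min lexx orbT.
have kb z : - alpha <= k z <= 1.
  rewrite /k; have /andP[? ?] := h01 z; have /andP[? ?] := c01 z.
  by apply/andP; split; nra.
have kq z : `|k z - q z| <= alpha * \1_(~` G) z.
  rewrite indicE; have [Gz|Gz] := pselect (G z).
    rewrite memNset; last by move=> /=.
    have /andP[? ?] := Ghc z Gz.
    by rewrite /q min_l ?max_r ?subrr ?normr0 ?mulr0//; rewrite /k; lra.
  rewrite mem_set// mulr1 ler_norml /q; have /andP[? ?] := kb z.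
  case: (leP (k z) (1 - alpha)) => ?; last by rewrite max_r; [lra|lra].
  by case: (leP 0 (k z)) => ?; lra.
have iq (N : probability Z R) : N.-integrable setT (EFin \o q).
  by apply: (@bounded_integrable _ _ 1) => // z; rewrite ger0_norm//; have := q1 z; lra.
have ik (N : probability Z R) : N.-integrable setT (EFin \o k).
  by apply: (@bounded_integrable _ _ 1) => // z; rewrite ler_norml; have := kb z; lra.
have ic (N : probability Z R) : N.-integrable setT (EFin \o c).
  by apply: (@bounded_integrable _ _ 1) => // z; rewrite ler_norml; have := c01 z; lra.
have iac (N : probability Z R) : N.-integrable setT (EFin \o (fun z => alpha * c z)).
  apply: (@bounded_integrable _ _ 1) => [|z]; first exact: measurable_funM.
  by rewrite ler_norml; have /andP[? ?] := c01 z; apply/andP; split; nra.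
have ikq (N : probability Z R) : N.-integrable setT (EFin \o (fun z => k z - q z)).
  by have := integrableB measurableT (ik N) (iq N).
(* Of the three parts, the mean of [c] is the same under both laws and cancels, [q] is compared
   through [Hu], and [k - q] vanishes on [G]. *)
have hE (N : probability Z R) :
    \int[N]_z h z = \int[N]_z q z + \int[N]_z (k z - q z) + alpha * \int[N]_z c z.
  rewrite -(RintegralD measurableT (iq N) (ikq N)).
  rewrite -(RintegralZl _ measurableT (ic N)).
  rewrite -(RintegralD measurableT _ (iac N)); last first.
    by have := integrableD measurableT (iq N) (ikq N).
  by apply: eq_Rintegral => z _; rewrite /k; ring.
have kqE (N : probability Z R) : `|\int[N]_z (k z - q z)| <= alpha * fine (N (~` G)).
  apply: (le_trans (le_normr_Rintegral measurableT (ikq N))).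
  apply: (@le_trans _ _ (\int[N]_z (alpha * \1_(~` G) z))).
    apply: le_Rintegral => //.
      by have := integrable_norm (ikq N).
    apply: (@bounded_integrable _ _ 1) => [|z].
      by apply: measurable_funM => //; exact: measurable_indic (measurableC mG).
    by rewrite indicE; case: (_ \in _); rewrite ?mulr1 ?mulr0 ?normr0// ger0_norm ltW.
  rewrite RintegralZl//; last first.
    apply: (@bounded_integrable _ _ 1) => [|z].
      exact: measurable_indic (measurableC mG).
    by rewrite indicE; case: (_ \in _); rewrite ?normr0 ?normr1.
  by rewrite /Rintegral integral_indic// ?setIT//; exact: measurableC.
(* Dividing [q] by [1 - alpha] gives a function with values in [0, 1], to which [Hu] applies; this
   produces the factor [1 - alpha] in front of [u]. *)
have qE (N : probability Z R) :
    \int[N]_z q z = (1 - alpha) * \int[N]_z ((1 - alpha)^-1 * q z).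
  by rewrite (RintegralZl _ measurableT (iq N)) mulrA mulfV ?mul1r// gt_eqF// subr_gt0.
have Hq : `|\int[M]_z ((1 - alpha)^-1 * q z) - \int[M']_z ((1 - alpha)^-1 * q z)| <= u.
  apply: Hu; first exact: measurable_funM.
  by move=> z; rewrite ler_pdivrMl ?subr_gt0// mulr1 q1 mulr_ge0// invr_ge0 subr_ge0 ltW.
move: Hq.
rewrite !hE !qE cE.
have Gf (N : probability Z R) : (N (~` G) = (fine (N (~` G)))%:E).
  by rewrite fineK// fin_num_measure//; exact: measurableC.
move: Ge; rewrite (Gf M) (Gf M') -EFinD lee_fin => Ge.
set x := (X in `|X - _| <= u -> _); set x' := (X in `|_ - X| <= u -> _).
have := kqE M; have := kqE M'.
set y := Rintegral M _ _; set y' := Rintegral M' _ _ => H1 H2 H3.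
rewrite [X in `|X|](_ : _ = (1 - alpha) * (x - x') + (y - y')); last first.
  by rewrite /x /x'; ring.
apply: (le_trans (ler_normD _ _)); rewrite normrM gtr0_norm ?subr_gt0//.
apply: lerD; first by rewrite ler_pM2l// subr_gt0.
apply: (le_trans (ler_normB _ _)); apply: (le_trans (lerD H2 H1)).
by rewrite -mulrDr ler_pM2l.
Qed.

End contraction.

(** * Uniform limits of probability measures *)

Section uniform_limit.
Context d (T : measurableType d) (R : realType) (L : nat -> probability T R).
Hypothesis L_cauchy : forall e : R, 0 < e -> exists N : nat,
  forall t s A, (N <= t)%N -> measurable A ->
  `|fine (L t A) - fine (L (t + s)%N A)| <= e.

Let l A : R := limn (fun t => fine (L t A)).

Let l_cvg A : measurable A -> fine (L t A) @[t --> \oo] --> l A.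
Proof.
move=> mA; apply/cauchy_cvgP; apply: cauchy_exP => e e0.
have e2 : 0 < e / 2 by rewrite divr_gt0.
have [N LN] := L_cauchy e2; exists (fine (L N A)); exists N => // t /= Nt.
rewrite /ball /= -(subnKC Nt); apply: (le_lt_trans (LN _ _ _ (leqnn _) mA)).
by rewrite ltr_pdivrMr// ltr_pMr// ltr1n.
Qed.

(** Let [s] tend to infinity in the Cauchy bound at a fixed set; the index [N] does not depend on
    that set. *)
Let l_unif (e : R) : 0 < e -> exists N : nat, forall t A, (N <= t)%N ->
  measurable A -> `|fine (L t A) - l A| <= e.
Proof.
move=> e0; have [N LN] := L_cauchy e0; exists N => t A Nt mA.
have cv : `|fine (L t A) - fine (L s A)| @[s --> \oo] --> `|fine (L t A) - l A|.
  by apply: cvg_norm; apply: cvgB; [exact: cvg_cst|exact: l_cvg].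
rewrite -(cvg_lim _ cv)//; apply: limr_le; first by apply/cvg_ex; eexists; exact: cv.
exists t => // s /= ts; rewrite -(subnKC ts); exact: LN.
Qed.

Let l_ge0 A : measurable A -> 0 <= l A.
Proof.
move=> mA; rewrite /l; apply: limr_ge; first by apply/cvg_ex; eexists; exact: l_cvg.
by near=> t; rewrite fine_ge0.
Unshelve. all: by end_near. Qed.

(** The maximum makes the value nonnegative on every set, measurable or not; on measurable sets [mu]
    is just the limit [l]. *)
Let mu A : \bar R := (Num.max 0 (l A))%:E.

Let muE A : measurable A -> mu A = (l A)%:E.
Proof. by move=> mA; rewrite /mu max_r// l_ge0. Qed.

Let mu0 : mu set0 = 0%E.
Proof.
rewrite muE//; congr EFin; apply: cvg_lim => //.
by under eq_fun do rewrite measure0; exact: cvg_cst.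
Qed.

Let mu_ge0 A : (0 <= mu A)%E.
Proof. by rewrite lee_fin le_max lexx. Qed.

Let l_sum (F : nat -> set T) n : (forall i, measurable (F i)) -> trivIset setT F ->
  l (\big[setU/set0]_(i < n) F i) = \sum_(i < n) l (F i).
Proof.
move=> mF tF; apply: cvg_lim => //.
under eq_fun => t.
  rewrite (measure_bigsetU (L t))// -sum_fine; last by move=> i _; exact: fin_num_measure.
  over.
elim: n => [|n IH].
  by rewrite big_ord0; under eq_fun do rewrite big_ord0; exact: cvg_cst.
rewrite big_ord_recr /= (_ : (fun _ => _) = (fun t : nat =>
    \sum_(i < n) fine (L t (F i)) + fine (L t (F n)))); last first.
  by apply/funext => t; rewrite big_ord_recr.
by apply: cvgD => //; exact: l_cvg.
Qed.

(** Three-epsilon argument: some [L N] is within [e / 3] of [l] on the union and on all finite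
    partial unions at once, and [L N] itself is sigma-additive. *)
Let mu_sigma_additive : semi_sigma_additive mu.
Proof.
move=> F mF tF mUF; rewrite muE//.
have -> : (fun n => \sum_(0 <= i < n) mu (F i))%E =
    EFin \o (fun n => l (\big[setU/set0]_(i < n) F i)).
  apply/funext => n /=; rewrite l_sum// big_mkord -sumEFin.
  by apply: eq_bigr => i _; rewrite muE.
apply: cvg_EFin; first by near=> n.
apply/cvgrPdist_le => e e0.
have e3 : 0 < e / 3 by rewrite divr_gt0.
have [N HN] := l_unif e3.
have : fine (L N (\big[setU/set0]_(i < n) F i)) @[n --> \oo] -->
    fine (L N (\bigcup_i F i)).
  apply: fine_cvg; rewrite fineK ?fin_num_measure//.
  rewrite (_ : (fun _ => _) = (fun n => \sum_(0 <= i < n) L N (F i))%E).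
    exact: measure_semi_sigma_additive.
  by apply/funext => n; rewrite measure_bigsetU// big_mkord.
move=> /cvgrPdist_le/(_ _ e3)[n0 _ Hn0]; exists n0 => // n /Hn0 /=.
set U := \bigcup_i F i; set V := \big[setU/set0]_(i < n) F i.
have mV : measurable V by exact: bigsetU_measurable.
have := HN N U (leqnn _) mUF; have := HN N V (leqnn _) mV.
rewrite !ler_norml; lra.
Unshelve. all: by end_near. Qed.

Let muT : mu setT = 1%E.
Proof.
rewrite muE//; congr EFin; apply: cvg_lim => //.
by under eq_fun do rewrite probability_setT; exact: cvg_cst.
Qed.

HB.instance Definition _ := isMeasure.Build _ _ _ mu mu0 mu_ge0 mu_sigma_additive.
HB.instance Definition _ := Measure_isProbability.Build _ _ _ mu muT.

Lemma uniform_limit_probability : exists nu : probability T R,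
  forall e : R, 0 < e -> exists N : nat, forall t A, (N <= t)%N ->
    measurable A -> `|fine (L t A) - fine (nu A)| <= e.
Proof.
exists mu => e /l_unif[N HN]; exists N => t A Nt mA.
by rewrite [in fine (mu A)]muE//; exact: HN.
Qed.

End uniform_limit.

(** * Random recursions with independent innovations *)

(** Rectangles are stable under intersection and generate the product sigma-algebra; finiteness of
    [m1] then gives uniqueness. *)
Lemma measure_eq_rectangles d1 d2 (T1 : measurableType d1)
    (T2 : measurableType d2) (R : realType)
    (m1 m2 : {measure set (T1 * T2) -> \bar R}) :
  (m1 setT < +oo)%E ->
  (forall A B, measurable A -> measurable B -> m1 (A `*` B) = m2 (A `*` B)) ->
  forall X, measurable X -> m1 X = m2 X.
Proof.
move=> m1oo m12 X mX.
pose C : set (set (T1 * T2)) :=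
  [set C | exists2 A, measurable A & exists2 B, measurable B & A `*` B = C].
apply: (measure_unique C (fun=> setT)) => //.
- by rewrite measurable_prod_measurableType.
- move=> _ _ [A1 mA1 [B1 mB1 <-]] [A2 mA2 [B2 mB2 <-]]; rewrite -setXI.
  by exists (A1 `&` A2); [exact: measurableI|exists (B1 `&` B2); [exact: measurableI|]].
- by move=> _; exists setT => //; exists setT => //; rewrite setXTT.
- by rewrite bigcup_const//; exists 0%N.
- by move=> _ [A mA [B mB <-]]; exact: m12.
Qed.

Lemma sigma_generated_preimage disp (Omega : measurableType disp) dT
    (T : measurableType dT) (I : Type) (D : set I) (X : I -> Omega -> T) i A :
  D i -> measurable A -> sigma_generated D X (X i @^-1` A).
Proof.
move=> Di mA; apply: sub_sigma_algebra; exists i => //.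
by exists A => //; rewrite setTI.
Qed.

Definition pushforward_measure d1 d2 (T1 : measurableType d1)
    (T2 : measurableType d2) (R : realType) (mu : {measure set T1 -> \bar R})
    (f : T1 -> T2) (mf : measurable_fun setT f) : {measure set T2 -> \bar R}.
Proof. refine (pushforward mu f : {measure set T2 -> \bar R}); exact: mf. Defined.

Section random_recursion.
Context disp (Omega : measurableType disp) (R : realType)
  (P : probability Omega R) dZ (Z : measurableType dZ) dW (W : measurableType dW).
Variables (zeta : nat -> {RV P >-> Z}) (xi : nat -> {RV P >-> W})
  (Psi : nat -> Z * W -> Z).
Hypothesis mPsi : forall n, measurable_fun setT (Psi n).
Hypothesis zetaS : forall n w, zeta n.+1 w = Psi n (zeta n w, xi n.+1 w).
Hypothesis xi_indep : mutually_independent P [set i | (1 <= i)%N] xi.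
Hypothesis xi_ident : identically_distributed P [set i | (1 <= i)%N] xi.
Hypothesis zeta0_indep : forall E D, measurable E ->
  sigma_generated [set i | (1 <= i)%N] xi D ->
  P (zeta 0 @^-1` E `&` D) = (P (zeta 0 @^-1` E) * P D)%E.

Let cyl (J : {fset nat}) (A : nat -> set W) :=
  \bigcap_(i in [set` J]) xi i @^-1` A i.

Let measurable_cyl J A : (forall i, i \in J -> measurable (A i)) ->
  measurable (cyl J A).
Proof.
move=> mA; apply: fin_bigcap_measurable => [|i Ji]; first exact: finite_fset.
by apply: measurable_preimageT => //; exact: mA.
Qed.

Let state_noise n w := (zeta n w, xi n.+1 w).

Let mpair n : measurable_fun setT (state_noise n).
Proof. exact: measurable_fun_pair. Qed.

(** Induction on [n]. The state [zeta n.+1] is a function of [state_noise n], so it suffices to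
    compare two measures on [Z * W]: the law of [state_noise n] restricted to the cylinder, and the
    full law times the mass of the cylinder. On rectangles this is the induction hypothesis for a
    larger cylinder. *)
Lemma recursion_indep_future n (J : {fset nat}) (A : nat -> set W) (E : set Z) :
  (forall i, i \in J -> (n < i)%N) -> (forall i, i \in J -> measurable (A i)) ->
  measurable E ->
  P (zeta n @^-1` E `&` \bigcap_(i in [set` J]) xi i @^-1` A i) =
  (P (zeta n @^-1` E) * P (\bigcap_(i in [set` J]) xi i @^-1` A i))%E.
Proof.
rewrite -/(cyl J A).
elim: n J A E => [|n IH] J A E nJ mA mE.
  apply: zeta0_indep => //.
  pose G := \bigcup_(i in [set i | (1 <= i)%N])
    preimage_set_system setT (xi i) measurable.
  apply: (@fin_bigcap_measurable _ (g_sigma_algebraType G)).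
    exact: finite_fset.
  by move=> i Ji; apply: sigma_generated_preimage; [exact: nJ|exact: mA].
have mD : measurable (cyl J A) by exact: measurable_cyl.
pose D : set Omega := cyl J A.
have PDfin : P D \is a fin_num by rewrite fin_num_measure.
pose p : {nonneg R} := NngNum (fine_ge0 (measure_ge0 P D)).
have mE' : measurable (Psi n @^-1` E) by exact: measurable_preimageT.
have preE : zeta n.+1 @^-1` E = (fun w => (zeta n w, xi n.+1 w)) @^-1` (Psi n @^-1` E).
  by apply/funext => w; rewrite /preimage /= zetaS.
rewrite preE [RHS]muleC -(fineK PDfin).
pose m1 := pushforward_measure (mrestr P mD) (mpair n).
pose m2 : {measure set (Z * W) -> \bar R} :=
  mscale p (pushforward_measure P (mpair n)).
rewrite -[LHS]/(m1 (Psi n @^-1` E)) -[RHS]/(m2 (Psi n @^-1` E)).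
apply: measure_eq_rectangles => //.
  rewrite /m1 /= /pushforward /mrestr /= preimage_setT setTI.
  by rewrite -ge0_fin_numE.
move=> B C mB mC; rewrite /m1 /m2 /= /mscale /= /pushforward /mrestr /=.
rewrite fineK//.
have nJ' : n.+1 \notin J by apply/negP => /nJ; rewrite ltnn.
have BC A' : (forall i, i \in J -> A' i = A i) -> A' n.+1 = C ->
    zeta n @^-1` B `&` cyl (n.+1 |` J)%fset A' =
    state_noise n @^-1` (B `*` C) `&` cyl J A.
  move=> A'A A'C; apply/seteqP; split => w.
    move=> [/= Bw Jw]; split.
      by split=> //=; rewrite -A'C; apply: Jw; rewrite /= in_fset1U eqxx.
    by move=> i /= iJ; rewrite /= -A'A//; apply: Jw; rewrite /= in_fset1U iJ orbT.
  move=> [[/= Bw Cw] Jw]; split => //= i /=; rewrite in_fset1U => /orP[/eqP ->|iJ].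
    by rewrite A'C.
  by rewrite /= A'A//; exact: Jw.
(* Adding the constraint [C] at index [n.+1] puts the next innovation among the future ones, where
   the induction hypothesis and [xi_indep] factor it out. *)
pose A' i := if i == n.+1 then C else A i.
have A'J i : i \in J -> A' i = A i.
  by move=> iJ; rewrite /A'; case: eqP => // iE; move: nJ'; rewrite -iE iJ.
have A'n : A' n.+1 = C by rewrite /A' eqxx.
have mA' i : i \in (n.+1 |` J)%fset -> measurable (A' i).
  by rewrite in_fset1U => /orP[/eqP ->|iJ]; rewrite ?A'n// A'J//; exact: mA.
have nJA' i : i \in (n.+1 |` J)%fset -> (n < i)%N.
  by rewrite in_fset1U => /orP[/eqP ->//|/nJ/ltnW].
rewrite -(BC A')// IH//.
have cylE : P (cyl (n.+1 |` J)%fset A') = (P (xi n.+1 @^-1` C) * P (cyl J A))%E.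
  rewrite xi_indep//; last by move=> i /= /nJA'; exact: leq_ltn_trans.
  rewrite big_fsetU1//= A'n xi_indep//; last by move=> i /= /nJ; exact: leq_ltn_trans.
  by congr (_ * _)%E; rewrite !big_seq; apply: eq_bigr => i iJ; rewrite A'J.
have n1C i : i \in [fset n.+1]%fset -> (n < i)%N by rewrite in_fset1 => /eqP ->.
have := IH [fset n.+1]%fset (fun=> C) B n1C (fun _ _ => mC) mB.
rewrite /cyl set_fset1 bigcap_set1 => IH1.
rewrite cylE (_ : state_noise n @^-1` (B `*` C) = zeta n @^-1` B `&` xi n.+1 @^-1` C)//.
by rewrite IH1 muleA muleC.
Qed.

Let kappa := distribution P (xi 1).

Let distribution_xi n A : measurable A -> P (xi n.+1 @^-1` A) = kappa A.
Proof. by move=> mA; exact: xi_ident. Qed.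

(** The case of the single future index [n.+1] gives the product formula on rectangles, and these
    determine the product measure. *)
Lemma recursion_law n (X : set (Z * W)) : measurable X ->
  P (state_noise n @^-1` X) = (distribution P (zeta n) \x kappa)%E X.
Proof.
move=> mX; rewrite (@product_measure_unique _ _ _ _ _ _ _
  (pushforward_measure P (mpair n)))// => B C mB mC.
rewrite /= -[RHS]/(P (zeta n @^-1` B) * kappa C)%E -(distribution_xi n)//.
have n1C i : i \in [fset n.+1]%fset -> (n < i)%N by rewrite in_fset1 => /eqP ->.
have := recursion_indep_future n1C (fun _ _ => mC) mB.
by rewrite set_fset1 bigcap_set1.
Qed.

Definition transition (n : nat) (f : Z -> \bar R) (z : Z) : \bar R :=
  \int[kappa]_e f (Psi n (z, e)).

(** The Markov property in integrated form: Tonelli for the product law of the current state and the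
    next innovation. *)
Lemma integral_transition n f : measurable_fun setT f -> (forall z, 0 <= f z)%E ->
  (\int[distribution P (zeta n.+1)]_z f z =
   \int[distribution P (zeta n)]_z transition n f z)%E.
Proof.
move=> mf f0; have mfP : measurable_fun setT (f \o Psi n) by exact: measurableT_comp.
rewrite /transition.
rewrite -(@fubini_tonelli1 _ _ _ _ _ (distribution P (zeta n)) kappa
  (f \o Psi n))//; last by move=> z; exact: f0.
transitivity (\int[pushforward_measure P (mpair n)]_z (f \o Psi n) z)%E; last first.
  by apply: eq_measure_integral => X mX _; exact: recursion_law.
rewrite !ge0_integral_pushforward//; last by move=> z _; exact: f0.
by apply: eq_integral => w _ /=; rewrite zetaS.
Qed.

End random_recursion.

(** * Euclidean norm and integral bounds *)

Section vector_measurability.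
Context (R : realType) (n : nat) d (T : measurableType d).

Lemma measurable_rVD (f g : T -> 'rV[R]_n) : measurable_fun setT f ->
  measurable_fun setT g -> measurable_fun setT (fun x => f x + g x).
Proof.
move=> mf mg; apply: measurable_fun_rV => i; under eq_fun do rewrite mxE.
by apply: measurable_funD; exact: (measurableT_comp (measurable_coord i)).
Qed.

Lemma measurable_rVZ (c : R) (f : T -> 'rV[R]_n) : measurable_fun setT f ->
  measurable_fun setT (fun x => c *: f x).
Proof.
move=> mf; apply: measurable_fun_rV => i; under eq_fun do rewrite mxE.
by apply: measurable_funM => //; exact: (measurableT_comp (measurable_coord i)).
Qed.

Lemma measurable_dotp (f g : T -> 'rV[R]_n) : measurable_fun setT f ->
  measurable_fun setT g -> measurable_fun setT (fun x => dotp (f x) (g x)).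
Proof.
move=> mf mg; apply: measurable_sum => i.
by apply: measurable_funM; exact: (measurableT_comp (measurable_coord i)).
Qed.

End vector_measurability.

Section dotp_theory.
Context (R : realType) (n : nat).
Implicit Types u v w : 'rV[R]_n.

Lemma dotpC u v : dotp u v = dotp v u.
Proof. by apply: eq_bigr => i _; rewrite mulrC. Qed.

Lemma dotpDl u v w : dotp (u + v) w = dotp u w + dotp v w.
Proof.
by rewrite /dotp -big_split /=; apply: eq_bigr => i _; rewrite mxE mulrDl.
Qed.

Lemma dotpZl a u v : dotp (a *: u) v = a * dotp u v.
Proof. by rewrite /dotp mulr_sumr; apply: eq_bigr => i _; rewrite mxE mulrA. Qed.

Lemma dotp_ge0 u : 0 <= dotp u u.
Proof. by apply: sumr_ge0 => i _; rewrite -expr2 sqr_ge0. Qed.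

Lemma enorm_sqr u : enorm u ^+ 2 = dotp u u.
Proof. by rewrite sqr_sqrtr// dotp_ge0. Qed.

Lemma enorm_ge0 u : 0 <= enorm u.
Proof. exact: sqrtr_ge0. Qed.

Lemma enorm_sqr_add u v : enorm (u + v) ^+ 2 =
  enorm u ^+ 2 + 2 * dotp u v + enorm v ^+ 2.
Proof.
rewrite !enorm_sqr dotpDl ![dotp _ (u + v)]dotpC !dotpDl (dotpC v u); ring.
Qed.

Lemma enorm_sqrZ a u : enorm (a *: u) ^+ 2 = a ^+ 2 * enorm u ^+ 2.
Proof. by rewrite !enorm_sqr dotpZl dotpC dotpZl mulrA expr2. Qed.

Lemma sqr_coord_le_enorm u i : u ord0 i ^+ 2 <= enorm u ^+ 2.
Proof.
rewrite enorm_sqr /dotp (bigD1 i)//= -expr2 lerDl.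
by apply: sumr_ge0 => j _; rewrite -expr2 sqr_ge0.
Qed.

Lemma coord_le_enorm u i : `|u ord0 i| <= enorm u.
Proof.
rewrite -(ler_pXn2r (ltn0Sn 1)) ?nnegrE ?enorm_ge0//.
by rewrite real_normK ?num_real// sqr_coord_le_enorm.
Qed.

Lemma measurable_enorm d (T : measurableType d) (f : T -> 'rV[R]_n) :
  measurable_fun setT f -> measurable_fun setT (fun x => enorm (f x)).
Proof.
move=> mf; rewrite /enorm.
apply: (measurableT_comp (continuous_measurable_fun (@sqrt_continuous R))).
exact: measurable_dotp.
Qed.

End dotp_theory.

Lemma sqr_add3_le (R : realDomainType) (x y z : R) :
  (x + y + z) ^+ 2 <= 3 * (x ^+ 2 + y ^+ 2 + z ^+ 2).
Proof.
have := sqr_ge0 (x - y); have := sqr_ge0 (x - z); have := sqr_ge0 (y - z).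
nra.
Qed.

Section probability_bounds.
Context d (T : measurableType d) (R : realType).

Lemma Rintegral01 (M : probability T R) (l : T -> R) : measurable_fun setT l ->
  (forall z, 0 <= l z <= 1) -> 0 <= \int[M]_z l z <= 1.
Proof.
move=> ml l01; apply/andP; split.
  by apply: Rintegral_ge0 => z _; case/andP: (l01 z).
have -> : 1 = \int[M]_z cst 1 z.
  by rewrite Rintegral_cst// mul1r; exact/esym/(congr1 fine (probability_setT M)).
apply: le_Rintegral => //.
- apply: (@bounded_integrable _ _ _ _ l 1) => // z.
  by rewrite ger0_norm; case/andP: (l01 z).
- by apply: (@bounded_integrable _ _ _ _ (cst 1) 1) => // z; rewrite normr1.
- by move=> z _; case/andP: (l01 z).
Qed.

Lemma measurable_gt (g : T -> R) (r : R) : measurable_fun setT g ->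
  measurable [set z | r < g z].
Proof.
move=> mg; rewrite (_ : [set _ | _] = g @^-1` `]r, +oo[%classic); last first.
  by apply/seteqP; split => z /=; rewrite in_itv/= andbT.
exact: measurable_preimageT.
Qed.

Lemma markov_tail (M : probability T R) (f : T -> R) (B r : R) :
  measurable_fun setT f -> (forall z, 0 <= f z) -> 0 < r ->
  (\int[M]_z (f z)%:E <= B%:E)%E -> (M [set z | (r < f z)%R] <= (B / r)%:E)%E.
Proof.
move=> mf f0 r0 fB; have mA := measurable_gt r mf.
rewrite EFinM lee_pdivlMr// muleC; apply: le_trans fB.
rewrite -[X in (_ * M X)%E]setIT -integral_indic// -ge0_integralZl//; last 2 first.
- exact/measurable_EFinP/measurable_indic.
- by rewrite lee_fin ltW.
apply: ge0_le_integral => //.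
- by move=> z _; rewrite mule_ge0// lee_fin ltW.
- by apply/measurable_EFinP; apply: measurable_funM => //; exact: measurable_indic.
- exact/measurable_EFinP.
move=> z _; rewrite -EFinM lee_fin indicE; case: (boolP (z \in _)) => /= zA.
  by rewrite mulr1; move: zA; rewrite inE /= => /ltW.
by rewrite mulr0.
Qed.

(** The lower bound is monotonicity of the integral in the measure; the upper bound is the lower
    bound applied to [1 - g]. *)
Lemma Rintegral_minorized d' (T' : measurableType d') (kappa : probability T' R)
    (nu : probability T R) (phi : T' -> T) (alpha : R) (g : T -> R) :
  0 <= alpha -> measurable_fun setT phi ->
  (forall A, measurable A -> (alpha%:E * nu A <= kappa (phi @^-1` A))%E) ->
  measurable_fun setT g -> (forall z, 0 <= g z <= 1) ->
  alpha * \int[nu]_z g z <= \int[kappa]_e g (phi e) <=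
    1 - alpha + alpha * \int[nu]_z g z.
Proof.
move=> a0 mphi Ha.
have lower (h : T -> R) : measurable_fun setT h -> (forall z, 0 <= h z <= 1) ->
    alpha * \int[nu]_z h z <= \int[kappa]_e h (phi e).
  move=> mh h01; pose ca : {nonneg R} := NngNum a0.
  have h0 z : (0 <= (h z)%:E)%E by rewrite lee_fin; case/andP: (h01 z).
  have mh' : measurable_fun setT (EFin \o h) by exact/measurable_EFinP.
  have H : (\int[mscale ca nu]_z (h z)%:E <=
      \int[pushforward_measure kappa mphi]_z (h z)%:E)%E.
    by apply: ge0_le_measure_integral => //; exact: Ha.
  move: H; rewrite ge0_integral_mscale// ge0_integral_pushforward//=.
  rewrite /comp => H.
  have fin1 : (\int[nu]_z (h z)%:E)%E \is a fin_num.
    apply: integrable_fin_num => //.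
    apply: (@bounded_integrable _ _ _ _ _ 1) => // z.
    by have /andP[? ?] := h01 z; rewrite ger0_norm.
  have fin2 : (\int[kappa]_e (h (phi e))%:E)%E \is a fin_num.
    apply: integrable_fin_num => //.
    apply: (@bounded_integrable _ _ _ _ (h \o phi) 1) => [|z].
      exact: measurableT_comp.
    by have /andP[? ?] := h01 (phi z); rewrite ger0_norm.
  by rewrite -lee_fin EFinM /Rintegral !fineK.
move=> mg g01; rewrite lower//=.
have := lower (fun z => 1 - g z).
have ig : nu.-integrable setT (EFin \o g).
  apply: (@bounded_integrable _ _ _ _ _ 1) => // z.
  by have /andP[? ?] := g01 z; rewrite ger0_norm.
have igp : kappa.-integrable setT (EFin \o (g \o phi)).
  apply: (@bounded_integrable _ _ _ _ _ 1) => [|z]; first exact: measurableT_comp.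
  by have /andP[? ?] := g01 (phi z); rewrite ger0_norm.
have i1 d1 (T1 : measurableType d1) (M : probability T1 R) :
    M.-integrable setT (EFin \o cst 1).
  by apply: (@bounded_integrable _ _ _ _ _ 1) => // z; rewrite normr1.
rewrite (RintegralB _ (i1 _ _ _) ig)// (RintegralB _ (i1 _ _ _) igp)//.
have c1 d1 (T1 : measurableType d1) (M : probability T1 R) : \int[M]_x cst 1 x = 1.
  by rewrite Rintegral_cst// mul1r; exact: (congr1 fine (probability_setT M)).
rewrite !c1.
have mg' : measurable_fun setT (fun z => 1 - g z) by exact: measurable_funB.
have g01' z : 0 <= 1 - g z <= 1 by have := g01 z; lra.
by move=> /(_ mg' g01'); rewrite /comp; lra.
Qed.

End probability_bounds.

(** * Second moment of an affine image of the noise *)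

Section noise.
Context disp (Omega : measurableType disp) (R : realType) (P : probability Omega R)
  (d : nat) (X : {RV P >-> 'rV[R]_d}) (sigma : R).
Hypothesis X_mean : forall k : 'I_d, ('E_P[(fun w => X w ord0 k)%R] = 0)%E.
Hypothesis X_var : ('E_P[(fun w => enorm (X w) ^+ 2)%R] = (sigma ^+ 2)%:E)%E.

Let mX : measurable_fun setT X. Proof. by []. Qed.

Let iXX : P.-integrable setT (EFin \o (fun w => enorm (X w) ^+ 2)).
Proof.
apply/integrableP; split.
  by apply/measurable_EFinP; apply: measurable_funX; exact: measurable_enorm.
under eq_integral do rewrite gee0_abs ?lee_fin ?sqr_ge0//.
by move: X_var; rewrite unlock => ->; rewrite ltry.
Qed.

(** Each coordinate is dominated by one plus the squared norm, because [(x - 1) ^+ 2] and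
    [(x + 1) ^+ 2] are nonnegative. *)
Let iX k : P.-integrable setT (EFin \o (fun w => X w ord0 k)).
Proof.
have i1 : P.-integrable setT (EFin \o cst 1).
  by apply: (@bounded_integrable _ _ _ _ _ 1) => // z; rewrite normr1.
apply: (le_integrable _ _ _ (integrableD measurableT i1 iXX)) => //.
  by apply/measurable_EFinP; apply: (measurableT_comp (measurable_coord k)).
move=> w _ /=; rewrite lee_fin.
have := sqr_coord_le_enorm (X w) k; set x := X w ord0 k; set s := enorm _ ^+ 2 => xs.
rewrite [leRHS]ger0_norm; last by have := sqr_ge0 x; lra.
by rewrite ler_norml; have := sqr_ge0 (x - 1); have := sqr_ge0 (x + 1); nra.
Qed.

(** Expand the square; the cross term has mean zero because every coordinate of the noise is
    centred. *)
Lemma expectation_enorm_sqr (a : 'rV[R]_d) (c : R) :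
  (\int[P]_w (enorm (a + c *: X w) ^+ 2)%:E =
   (enorm a ^+ 2 + c ^+ 2 * sigma ^+ 2)%:E)%E.
Proof.
have i1 : P.-integrable setT (EFin \o cst (enorm a ^+ 2)).
  by apply: (@bounded_integrable _ _ _ _ _ `|enorm a ^+ 2|).
have iaX k : P.-integrable setT (fun w => (a ord0 k * X w ord0 k)%:E).
  by under eq_fun do rewrite EFinM; exact: (integrableZl measurableT _ (iX k)).
have iS : P.-integrable setT (EFin \o (fun w => dotp a (X w))).
  rewrite (_ : _ \o _ = fun w => \sum_k (a ord0 k * X w ord0 k)%:E)%E; last first.
    by apply/funext => w /=; rewrite sumEFin.
  exact: integrable_sum.
have ES : (\int[P]_w (dotp a (X w))%:E = 0)%E.
  under eq_integral do rewrite -sumEFin.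
  rewrite integral_sum//; apply: big1 => k _.
  under eq_integral do rewrite EFinM.
  rewrite integralZl//; last exact: iX.
  by have := X_mean k; rewrite unlock => ->; rewrite mule0.
transitivity (\int[P]_w ((enorm a ^+ 2)%:E + ((2 * c)%:E * (dotp a (X w))%:E +
    (c ^+ 2)%:E * (enorm (X w) ^+ 2)%:E)))%E.
  apply: eq_integral => w _; rewrite enorm_sqr_add enorm_sqrZ (dotpC a) dotpZl dotpC.
  by rewrite -!EFinM -!EFinD; congr EFin; ring.
rewrite integralD//; last first.
  by apply: integrableD => //; exact: integrableZl.
rewrite integralD//; [|exact: integrableZl|exact: integrableZl].
rewrite !integralZl// ES mule0 add0e.
move: X_var; rewrite unlock => ->.
by rewrite integral_cst// [X in (_ * X + _)%E](probability_setT P) mule1 -EFinM -EFinD.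
Qed.

End noise.

(** * The recursion in a stationary environment *)

Section chain.
Context (R : realType) (d m : nat) (disp : measure_display)
  (Omega : measurableType disp) (P : probability Omega R)
  (xi : nat -> {RV P >-> 'rV[R]_d}) (Y : int -> {RV P >-> 'rV[R]_m})
  (H : 'rV[R]_d * 'rV[R]_m -> 'rV[R]_d) (lambda : R).
Hypothesis xi_indep : mutually_independent P [set i | (1 <= i)%N] xi.
Hypothesis xi_ident : identically_distributed P [set i | (1 <= i)%N] xi.
Hypothesis Y_stationary : strictly_stationary P Y.
Hypothesis Y_xi_indep : independent_systems P (sigma_generated setT Y)
  (sigma_generated [set i | (1 <= i)%N] xi).
Hypothesis H_meas : measurable_fun setT H.

(* [Omega] with the sigma-algebra generated by [Y]: a law on ['rV_d * env] is a
   joint law of the state and the whole environment. *)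
Definition env := g_sigma_algebraType
  (\bigcup_(i in setT) preimage_set_system setT (Y i) measurable).

Lemma measurable_Y_env i : measurable_fun setT (Y i : env -> 'rV[R]_m).
Proof. by move=> _ A mA; rewrite setTI; exact: sigma_generated_preimage. Qed.

Lemma measurable_env (A : set env) : measurable A -> measurable (A : set Omega).
Proof.
apply: smallest_sub; first exact: sigma_algebra_measurable.
by move=> _ [i _ [B mB <-]]; rewrite setTI; exact: measurable_preimageT.
Qed.

Lemma measurable_to_env : measurable_fun setT (id : Omega -> env).
Proof. by move=> _ A mA; rewrite setTI; exact: measurable_env. Qed.

Definition step (x : 'rV[R]_d) (y : 'rV[R]_m) (e : 'rV[R]_d) : 'rV[R]_d :=
  x - lambda *: H (x, y) + Num.sqrt lambda *: e.

Lemma measurable_step d' (T : measurableType d') (f g : T -> 'rV[R]_d)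
    (h : T -> 'rV[R]_m) : measurable_fun setT f -> measurable_fun setT h ->
  measurable_fun setT g -> measurable_fun setT (fun x => step (f x) (h x) (g x)).
Proof.
move=> mf mh mg; rewrite /step; apply: measurable_rVD; last exact: measurable_rVZ.
under eq_fun do rewrite -scaleN1r.
apply: measurable_rVD => //; do 2 apply: measurable_rVZ.
by apply: measurableT_comp => //; exact: measurable_fun_pair.
Qed.

Section shifted.
Variables (k : int) (theta0 : 'rV[R]_d).

(* The recursion started at time [- k]. *)
Definition chain (n : nat) : Omega -> 'rV[R]_d :=
  theta_process H xi (fun t => Y (t - k)) lambda theta0 n.

Lemma measurable_chain n : measurable_fun setT (chain n).
Proof.
by elim: n => [|n IH]; [exact: measurable_cst|exact: measurable_step].
Qed.

Definition state (n : nat) (w : Omega) : 'rV[R]_d * env := (chain n w, w).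

Lemma measurable_state n : measurable_fun setT (state n).
Proof.
apply: measurable_fun_pair; first exact: measurable_chain.
exact: measurable_to_env.
Qed.

HB.instance Definition _ n :=
  isMeasurableFun.Build _ _ _ _ _ (measurable_state n).

(** The environment is carried along unchanged. Step [n] of a recursion started at time [- k] reads
    it at time [n - k]. *)
Definition state_step (n : nat) (p : ('rV[R]_d * env) * 'rV[R]_d) :
  'rV[R]_d * env := (step p.1.1 (Y (n%:Z - k) p.1.2) p.2, p.1.2).

Lemma measurable_state_step n : measurable_fun setT (state_step n).
Proof.
apply: measurable_fun_pair; last exact: measurableT_comp.
apply: measurable_step => //; first exact: measurableT_comp.
by apply: measurableT_comp; [exact: measurable_Y_env|exact: measurableT_comp].
Qed.

(** The initial state is deterministic, so an event about [state 0] belongs to the sigma-algebra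
    generated by [Y]. *)
Lemma state0_indep E D : measurable E ->
  sigma_generated [set i | (1 <= i)%N] xi D ->
  P (state 0 @^-1` E `&` D) = (P (state 0 @^-1` E) * P D)%E.
Proof.
move=> mE; apply: Y_xi_indep.
apply: (@measurable_preimageT _ _ env _ (fun w => (theta0, w))) => //.
exact: measurable_fun_pair.
Qed.

Definition state_law (n : nat) := distribution P (state n).

Lemma integral_state_transition n (f : 'rV[R]_d * env -> \bar R) :
  measurable_fun setT f -> (forall z, 0 <= f z)%E ->
  (\int[state_law n.+1]_z f z =
   \int[state_law n]_z \int[distribution P (xi 1)]_e f (state_step n (z, e)))%E.
Proof.
apply: (@integral_transition _ _ _ _ _ _ _ _ state xi) => //.
- exact: measurable_state_step.
- exact: state0_indep.
Qed.

End shifted.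

Local Notation kappa := (distribution P (xi 1)).

(** * Shift invariance of the chain laws *)

Let Ytuple N (t : 'I_N -> int) (w : Omega) : N.-tuple 'rV[R]_m :=
  [tuple Y (t i) w | i < N].

Let measurable_Ytuple N (t : 'I_N -> int) :
  measurable_fun setT (Ytuple t : env -> _).
Proof.
apply/measurable_fun_tnthP => i; rewrite (_ : _ \o _ = Y (t i)).
  exact: measurable_Y_env.
by apply/funext => w /=; rewrite tnth_mktuple.
Qed.

Let tail N (v : N.+1.-tuple 'rV[R]_m) : N.-tuple 'rV[R]_m :=
  [tuple tnth v (lift ord0 i) | i < N].

Let measurable_tail N : measurable_fun setT (@tail N).
Proof.
apply/measurable_fun_tnthP => i.
rewrite (_ : _ \o _ = (@tnth _ _)^~ (lift ord0 i)); first exact: measurable_tnth.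
by apply/funext => w /=; rewrite tnth_mktuple.
Qed.

(** Induction on [n], with the finite family of observed times left general. Integrating out one
    innovation replaces [f] by a function of the previous state and of one more environment value,
    the one read at that step. At [n = 0] only environment values remain, and stationarity
    applies. *)
Lemma chain_shift_invariant k theta0 n N (t : 'I_N -> int)
    (f : 'rV[R]_d * N.-tuple 'rV[R]_m -> \bar R) :
  measurable_fun setT f -> (forall z, 0 <= f z)%E ->
  (\int[state_law k theta0 n]_z f (z.1, Ytuple (fun i => t i - k)%R z.2) =
   \int[state_law 0 theta0 n]_z f (z.1, Ytuple t z.2))%E.
Proof.
have mfY N' (t' : 'I_N' -> int) (f' : 'rV[R]_d * N'.-tuple 'rV[R]_m -> \bar R) :
    measurable_fun setT f' ->
    measurable_fun setT (fun z : 'rV[R]_d * env => f' (z.1, Ytuple t' z.2)).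
  move=> mf; apply: (measurableT_comp mf); apply: measurable_fun_pair => //.
  exact: (measurableT_comp (measurable_Ytuple t')).

elim: n N t f => [|n IH] N t f mf f0.
  rewrite !ge0_integral_distribution//; try exact: mfY.
  pose g v := f (theta0, v).
  have mg : measurable_fun setT g.
    by apply: measurableT_comp => //; exact: measurable_fun_pair.
  have mYO t' : measurable_fun setT (@Ytuple N t').
    exact: (measurableT_comp (measurable_Ytuple t') measurable_to_env).
  transitivity (\int[pushforward_measure P (mYO (fun i => t i - k)%R)]_v g v)%E.
    by rewrite ge0_integral_pushforward// => v _; exact: f0.
  transitivity (\int[pushforward_measure P (mYO t)]_v g v)%E; last first.
    by rewrite ge0_integral_pushforward// => v _; exact: f0.
  by apply: eq_measure_integral => A mA _; exact: Y_stationary.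
(* The time [n] read by the step is put in slot [ord0], where [unlift] returns [None]; the old times
   follow. *)
pose t' (i : 'I_N.+1) : int := oapp t n%:Z (unlift ord0 i).
pose g (z : 'rV[R]_d * N.+1.-tuple 'rV[R]_m) : \bar R :=
  (\int[kappa]_e f (step z.1 (tnth z.2 ord0) e, tail z.2))%E.
have mg : measurable_fun setT g.
  apply: (@measurable_fun_fubini_tonelli_F _ _ _ _ _ kappa
    (fun p => f (step p.1.1 (tnth p.1.2 ord0) p.2, tail p.1.2))) => //.
  apply: measurableT_comp => //; apply: measurable_fun_pair.
    apply: measurable_step => //; first exact: (measurableT_comp measurable_fst).
    apply: (measurableT_comp (measurable_tnth ord0)).
    exact: (measurableT_comp measurable_snd).
  apply: (measurableT_comp (@measurable_tail N)).
  exact: (measurableT_comp measurable_snd).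
have g0 z : (0 <= g z)%E by apply: integral_ge0.
have gE j : (\int[state_law j theta0 n.+1]_z f (z.1, Ytuple (fun i => t i - j)%R z.2) =
    \int[state_law j theta0 n]_z g (z.1, Ytuple (fun i => t' i - j)%R z.2))%E.
  pose fY (z : 'rV[R]_d * env) := f (z.1, Ytuple (fun i => t i - j)%R z.2).
  have mfYj : measurable_fun setT fY by exact: mfY.
  have fY0 z : (0 <= fY z)%E by exact: f0.
  rewrite -/(\int[state_law j theta0 n.+1]_z fY z)%E.
  rewrite (integral_state_transition j theta0 n mfYj fY0).
  apply: eq_integral => z _; apply: eq_integral => e _; congr (f (_, _)).
    by rewrite /= tnth_mktuple /t' unlift_none.
  by apply: eq_from_tnth => i; rewrite !tnth_mktuple /t' liftK.
have t0 N' (s : 'I_N' -> int) : (fun i => s i - 0)%R = s.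
  by apply/funext => i; rewrite subr0.
by rewrite gE IH//; have := gE 0; rewrite !t0 => ->.
Qed.

(** * Drift inequality and uniform second moments *)

Variables (sigma Delta : R) (b : 'rV[R]_m -> R) (K1 K2 K3 beta My Mb : R).
Hypothesis xi_mean : forall k : 'I_d, ('E_P[(fun w => xi 1 w ord0 k)%R] = 0)%E.
Hypothesis xi_var : ('E_P[(fun w => enorm (xi 1 w) ^+ 2)%R] = (sigma ^+ 2)%:E)%E.
Hypothesis b_meas : measurable_fun setT b.
Hypothesis b_ge0 : forall y, 0 <= b y.
Hypothesis H_dissip : forall (th : 'rV[R]_d) (y : 'rV[R]_m),
  Delta * enorm th ^+ 2 - b y <= dotp (H (th, y)) th.
Hypothesis H_growth : forall (th : 'rV[R]_d) (y : 'rV[R]_m),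
  enorm (H (th, y)) <= K1 * enorm th + K2 * enorm y `^ beta + K3.
Hypothesis Y_moment : ('E_P[(fun w => enorm (Y 0 w) `^ (2 * beta))%R] <= My%:E)%E.
Hypothesis b_moment : ('E_P[(fun w => b (Y 0 w))%R] <= Mb%:E)%E.
Hypotheses (Delta_gt0 : 0 < Delta) (lambda_gt0 : 0 < lambda)
  (lambda_Delta : lambda * Delta <= 1) (lambda_K1 : 3 * K1 ^+ 2 * lambda <= Delta).

Let envY (y : 'rV[R]_m) := enorm y `^ (2 * beta).

Lemma H_sqr_bound x y :
  enorm (H (x, y)) ^+ 2 <= 3 * (K1 ^+ 2 * enorm x ^+ 2 + K2 ^+ 2 * envY y + K3 ^+ 2).
Proof.
have -> : envY y = (enorm y `^ beta) ^+ 2.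
  by rewrite /envY mulrC powRrM powR_mulrn// powR_ge0.
have := H_growth x y => Hxy.
rewrite -!exprMn; apply: le_trans (sqr_add3_le _ _ _).
by rewrite lerXn2r// ?nnegrE ?enorm_ge0//; apply: le_trans Hxy; exact: enorm_ge0.
Qed.

Lemma integral_Y_stationary i (g : 'rV[R]_m -> R) : measurable_fun setT g ->
  (forall y, 0 <= g y) ->
  (\int[P]_w (g (Y i w))%:E = \int[P]_w (g (Y 0 w))%:E)%E.
Proof.
move=> mg g0.
have E j : (\int[P]_w (g (Y j w))%:E = \int[distribution P (Y j)]_y (g y)%:E)%E.
  by rewrite ge0_integral_distribution//; exact/measurable_EFinP.
rewrite !E; apply: eq_measure_integral => A mA _.
have mA' : measurable ((fun v : 1.-tuple 'rV[R]_m => tnth v ord0) @^-1` A).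
  by apply: measurable_preimageT => //; exact: measurable_tnth.
have := Y_stationary (fun=> 0) i mA'.
rewrite /preimage /= /distribution /pushforward /preimage.
under [in X in X = _]eq_set do rewrite tnth_mktuple add0r.
by under [in X in _ = X]eq_set do rewrite tnth_mktuple.
Qed.

(** Bound on the mean of [q] below, with [b] and [envY] replaced by their moment bounds. *)
Let Cq := 2 * lambda * Mb + 3 * lambda ^+ 2 * K2 ^+ 2 * My +
  3 * lambda ^+ 2 * K3 ^+ 2 + lambda * sigma ^+ 2.

(** The additive term of the drift inequality: [b] comes from dissipativity, [K2] and [K3] from the
    growth bound, [sigma] from the noise. *)
Let q y := 2 * lambda * b y + 3 * lambda ^+ 2 * K2 ^+ 2 * envY y +
  (3 * lambda ^+ 2 * K3 ^+ 2 + lambda * sigma ^+ 2).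

Let mVY : measurable_fun setT envY.
Proof.
apply: (measurableT_comp (measurable_powR _)).
by apply: measurable_enorm.
Qed.

Let envY_ge0 y : 0 <= envY y. Proof. exact: powR_ge0. Qed.

Let mq : measurable_fun setT q.
Proof.
by apply: measurable_funD => //; apply: measurable_funD; exact: measurable_funM.
Qed.

Let q_ge0 y : 0 <= q y.
Proof.
have := ltW lambda_gt0 => l0.
by rewrite /q; do ![exact: sqr_ge0 | apply: addr_ge0 | apply: mulr_ge0 => //].
Qed.

Let integral_q i : (\int[P]_w (q (Y i w))%:E <= Cq%:E)%E.
Proof.
rewrite integral_Y_stationary//.
have l0 := ltW lambda_gt0.
have mbE : measurable_fun setT (fun w => (b (Y 0 w))%:E).
  by apply/measurable_EFinP; exact: (measurableT_comp b_meas).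
have mVE : measurable_fun setT (fun w => (envY (Y 0 w))%:E).
  by apply/measurable_EFinP; exact: (measurableT_comp mVY).
have c1 : (0 <= (2 * lambda)%:E)%E by rewrite lee_fin mulr_ge0.
have c2 : (0 <= (3 * lambda ^+ 2 * K2 ^+ 2)%:E)%E.
  by rewrite lee_fin; do ![exact: sqr_ge0 | apply: mulr_ge0 => //].
have c3 : (0 <= (3 * lambda ^+ 2 * K3 ^+ 2 + lambda * sigma ^+ 2)%:E)%E.
  by rewrite lee_fin; do ![exact: sqr_ge0 | apply: addr_ge0 | apply: mulr_ge0 => //].
have qE w : ((q (Y 0 w))%:E = (2 * lambda)%:E * (b (Y 0 w))%:E +
    (3 * lambda ^+ 2 * K2 ^+ 2)%:E * (envY (Y 0 w))%:E +
    (3 * lambda ^+ 2 * K3 ^+ 2 + lambda * sigma ^+ 2)%:E)%E.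
  by rewrite -!EFinM -!EFinD.
under eq_integral do rewrite qE.
rewrite ge0_integralD//; last 2 first.
- by move=> w _; do ![apply: adde_ge0 | apply: mule_ge0 => //]; rewrite lee_fin.
- by apply: emeasurable_funD; exact: measurable_funeM.
rewrite ge0_integralD//; last 4 first.
- by move=> w _; rewrite mule_ge0// lee_fin.
- exact: measurable_funeM.
- by move=> w _; rewrite mule_ge0// lee_fin.
- exact: measurable_funeM.
rewrite !ge0_integralZl//; last 2 first.
- by move=> w _; rewrite lee_fin.
- by move=> w _; rewrite lee_fin.
rewrite integral_cst// [X in (_ + _ * X)%E](probability_setT P) mule1.
rewrite (_ : Cq%:E = (2 * lambda * Mb)%:E + (3 * lambda ^+ 2 * K2 ^+ 2 * My)%:E +
    (3 * lambda ^+ 2 * K3 ^+ 2 + lambda * sigma ^+ 2)%:E)%E; last first.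
  by rewrite -!EFinD /Cq -addrA.
apply: leeD => //; apply: leeD.
  by rewrite [leRHS]EFinM; apply: lee_wpmul2l => //; move: b_moment; rewrite unlock.
by rewrite [leRHS]EFinM; apply: lee_wpmul2l => //; move: Y_moment; rewrite unlock.
Qed.

(** With the environment fixed, expand the square and average over the noise. Dissipativity gains
    [2 * lambda * Delta] times the squared norm; as [3 * K1 ^+ 2 * lambda <= Delta], the quadratic
    growth of [H] uses up at most half of this gain. *)
Lemma drift k n (x : 'rV[R]_d) (w : env) :
  (\int[kappa]_e (enorm (state_step k n ((x, w), e)).1 ^+ 2)%:E <=
   ((1 - lambda * Delta) * enorm x ^+ 2 + q (Y (n%:Z - k) w))%:E)%E.
Proof.
rewrite ge0_integral_distribution//; last 2 first.
- apply/measurable_EFinP; apply: measurable_funX; apply: measurable_enorm.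
  exact: (@measurable_step _ _ (cst x) id (cst (Y (n%:Z - k) w))).
- by move=> e; rewrite lee_fin sqr_ge0.
rewrite /= /step (expectation_enorm_sqr xi_mean xi_var) lee_fin.
rewrite [Num.sqrt lambda ^+ 2]sqr_sqrtr; last exact: ltW.
set y := Y _ w.
rewrite -scaleNr enorm_sqr_add enorm_sqrZ (dotpC x) dotpZl sqrrN.
have := H_dissip x y; have := H_sqr_bound x y; rewrite /q -/y.
set h2 := enorm (H _) ^+ 2; set x2 := enorm x ^+ 2; set dp := dotp _ _.
have x20 : 0 <= x2 by exact: sqr_ge0.
move=> h2le dple.
have L2 : 0 < lambda ^+ 2 by rewrite exprn_gt0.
have e1 : lambda * (Delta * x2 - b y) <= lambda * dp by rewrite ler_pM2l.
have e2 : lambda ^+ 2 * h2 <=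
    lambda ^+ 2 * (3 * (K1 ^+ 2 * x2 + K2 ^+ 2 * envY y + K3 ^+ 2)).
  by rewrite ler_pM2l.
have e3 : 3 * K1 ^+ 2 * lambda * (lambda * x2) <= Delta * (lambda * x2).
  by apply: ler_wpM2r => //; rewrite mulr_ge0// ltW.
lra.
Qed.

(** The drift bound is a sum of a state term and an environment term, so it integrates termwise, and
    stationarity bounds the environment term by [Cq] at every time. *)
Lemma chain_moment k theta0 n :
  (\int[state_law k theta0 n]_z (enorm z.1 ^+ 2)%:E <=
   (enorm theta0 ^+ 2 + Cq / (lambda * Delta))%:E)%E.
Proof.
have lD : 0 < lambda * Delta by exact: mulr_gt0.
have Cq0 : 0 <= Cq.
  rewrite -lee_fin; apply: le_trans (integral_q 0); apply: integral_ge0 => w _.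
  by rewrite lee_fin.
(* [Cq / (lambda * Delta)] is the fixed point of [v = (1 - lambda * Delta) * v + Cq]; adding the
   initial squared norm keeps [B] stable under the recursion. *)
set B := _ + _; have CqB : Cq <= lambda * Delta * B.
  rewrite /B mulrDr [X in _ + X]mulrC divfK ?gt_eqF// lerDr.
  by rewrite mulr_ge0 ?sqr_ge0// ltW.
have mV : measurable_fun setT (fun z : 'rV[R]_d * env => (enorm z.1 ^+ 2)%:E).
  by apply/measurable_EFinP; apply: measurable_funX; exact: measurable_enorm.
have V0 (z : 'rV[R]_d * env) : (0 <= (enorm z.1 ^+ 2)%:E)%E by rewrite lee_fin sqr_ge0.
elim: n => [|n IH].
  rewrite ge0_integral_distribution// (eq_integral (cst (enorm theta0 ^+ 2)%:E))//.
  rewrite integral_cst//.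
  rewrite [X in (_ * X)%E](probability_setT P) mule1 lee_fin lerDl.
  by rewrite divr_ge0// ltW.
rewrite integral_state_transition//.
have mqY : measurable_fun setT (fun z : 'rV[R]_d * env => (q (Y (n%:Z - k) z.2))%:E).
  apply/measurable_EFinP; apply: (measurableT_comp mq).
  exact: (measurableT_comp (measurable_Y_env _) measurable_snd).
have c0 : 0 <= 1 - lambda * Delta by rewrite subr_ge0.
apply: (@le_trans _ _ (\int[state_law k theta0 n]_z
    ((1 - lambda * Delta)%:E * (enorm z.1 ^+ 2)%:E + (q (Y (n%:Z - k) z.2))%:E))%E).
  apply: ge0_le_integral => //.
  - by move=> z _; apply: integral_ge0 => e _; rewrite lee_fin sqr_ge0.
  - apply: (@measurable_fun_fubini_tonelli_F _ _ _ _ _ kappa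
      (fun p => (enorm (state_step k n p).1 ^+ 2)%:E)).
      apply: (measurableT_comp mV); exact: measurable_state_step.
    by move=> p; rewrite lee_fin sqr_ge0.
  - by apply: emeasurable_funD => //; exact: measurable_funeM.
  - by move=> [x w] _; exact: drift.
rewrite ge0_integralD//; last 3 first.
- by move=> z _; rewrite mule_ge0.
- exact: measurable_funeM.
- by move=> z _; rewrite lee_fin.
rewrite ge0_integralZl//.
apply: (@le_trans _ _ ((1 - lambda * Delta)%:E * B%:E + Cq%:E)%E).
  apply: leeD; first by apply: lee_wpmul2l => //; rewrite lee_fin.
  rewrite ge0_integral_distribution//; first exact: integral_q.
  by move=> z; rewrite lee_fin.
by rewrite -EFinM -EFinD lee_fin; lra.
Qed.

(** * Minorization of the kernel and contraction of the joint laws *)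

Variable f : 'rV[R]_d -> R.
Hypothesis xi_density : has_density P (xi 1) (lebesgue_rV R d) f.
Hypothesis f_inf : forall K : set 'rV[R]_d, compact K ->
  (0 < ereal_inf [set (f x)%:E | x in K])%E.

(** At levels at most [r], the growth bound confines [x - lambda *: H (x, y)] to a bounded box, so
    [density_minorization] applies with scale [Num.sqrt lambda] and an [alpha] common to all such
    [x] and [y]. *)
Lemma step_minorization (r : R) : exists alpha, [/\ 0 < alpha, alpha < 1 &
  forall x y A, enorm x ^+ 2 <= r -> envY y <= r -> measurable A ->
    (alpha%:E * @uniform_cube R d A <= kappa (step x y @^-1` A))%E].
Proof.
have sl : 0 < Num.sqrt lambda by rewrite sqrtr_gt0.
pose h := 3 * (K1 ^+ 2 * r + K2 ^+ 2 * r + K3 ^+ 2).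
have [alpha [a0 a1 Ha]] := density_minorization
  (Num.sqrt r + lambda * Num.sqrt h) xi_density f_inf sl.
exists alpha; split => // x y A xr yr mA.
apply: Ha => // i; rewrite !mxE.
have sq a c : 0 <= a -> a ^+ 2 <= c -> a <= Num.sqrt c :> R.
  by move=> a_ge0 ac; rewrite -(ger0_norm a_ge0) -sqrtr_sqr ler_wsqrtr.
apply: (le_trans (ler_normB _ _)); apply: lerD.
  by apply: (le_trans (coord_le_enorm x i)); apply: sq => //; exact: enorm_ge0.
rewrite normrM gtr0_norm// ler_pM2l//.
apply: (le_trans (coord_le_enorm _ i)); apply: sq; first exact: enorm_ge0.
apply: (le_trans (H_sqr_bound x y)); rewrite ler_pM2l// lerD2r lerD//.
  by rewrite ler_wpM2l// sqr_ge0.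
by rewrite ler_wpM2l// sqr_ge0.
Qed.

(** Total variation closeness, tested on functions with values in [0, 1] rather than on sets,
    because averaging over a step turns an indicator into such a function. *)
Definition law_close (M M' : probability ('rV[R]_d * env)%type R) (u : R) :=
  forall g : 'rV[R]_d * env -> R, measurable_fun setT g ->
    (forall z, 0 <= g z <= 1) -> `|\int[M]_z g z - \int[M']_z g z| <= u.

Let mean_step n (g : 'rV[R]_d * env -> R) (z : 'rV[R]_d * env) : R :=
  \int[kappa]_e g (state_step 0 n (z, e)).

Let mean_stepE n (g : 'rV[R]_d * env -> R) z :
  measurable_fun setT g -> (forall z, 0 <= g z <= 1) ->
  (mean_step n g z)%:E = (\int[kappa]_e (g (state_step 0 n (z, e)))%:E)%E.
Proof.
move=> mg g01; rewrite /mean_step /Rintegral fineK//.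
apply: integrable_fin_num => //.
apply: (@bounded_integrable _ _ _ kappa (fun e => g (state_step 0 n (z, e))) 1).
  apply: measurableT_comp => //.
  by apply: measurableT_comp; [exact: measurable_state_step|exact: measurable_fun_pair].
by move=> e; rewrite ger0_norm; case/andP: (g01 (state_step 0 n (z, e))).
Qed.

Let measurable_mean_step n (g : 'rV[R]_d * env -> R) : measurable_fun setT g ->
  (forall z, 0 <= g z <= 1) -> measurable_fun setT (mean_step n g).
Proof.
move=> mg g01; apply/measurable_EFinP.
rewrite (_ : _ \o _ = fun z => (\int[kappa]_e (g (state_step 0 n (z, e)))%:E)%E).
  apply: (@measurable_fun_fubini_tonelli_F _ _ _ _ _ kappa
    (fun p => (g (state_step 0 n p))%:E)).
    apply/measurable_EFinP; apply: measurableT_comp => //.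
    exact: measurable_state_step.
  by move=> p; rewrite lee_fin; case/andP: (g01 (state_step 0 n p)).
by apply/funext => z; rewrite -mean_stepE.
Qed.

(** The chain started at [- k] reads [Y] at time [n] in its step [k + n], so its update is the same
    [mean_step n] as for the chain started at time 0. *)
Let integral_mean_step (k : nat) theta0 n (g : 'rV[R]_d * env -> R) :
  measurable_fun setT g -> (forall z, 0 <= g z <= 1) ->
  \int[state_law k%:Z theta0 (k + n).+1]_z g z =
  \int[state_law k%:Z theta0 (k + n)]_z mean_step n g z.
Proof.
move=> mg g01; rewrite /Rintegral integral_state_transition//; last 2 first.
- exact/measurable_EFinP.
- by move=> z; rewrite lee_fin; case/andP: (g01 z).
congr fine; apply: eq_integral => z _.
rewrite (mean_stepE n z mg g01); apply: eq_integral => e _; rewrite /state_step.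
by rewrite (_ : (k + n)%N%:Z - k%:Z = n%:Z - 0)// subr0 PoszD addrAC subrr add0r.
Qed.

(** The environment marginal of a joint law is the same for all chains and times. *)
Let integral_env k theta0 n (c : env -> R) : measurable_fun setT c ->
  (forall w, 0 <= c w) ->
  (\int[state_law k theta0 n]_z (c z.2)%:E = \int[P]_w (c w)%:E)%E.
Proof.
move=> mc c0; rewrite ge0_integral_distribution//.
- by apply/measurable_EFinP; exact: (measurableT_comp mc measurable_snd).
- by move=> z; rewrite lee_fin.
Qed.

Let good n r : set ('rV[R]_d * env) :=
  [set z | enorm z.1 ^+ 2 <= r /\ envY (Y n%:Z z.2) <= r].

Let measurable_enorm_sqr_fst :
  measurable_fun setT (fun z : 'rV[R]_d * env => enorm z.1 ^+ 2).
Proof. by apply: measurable_funX; exact: measurable_enorm. Qed.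

Let measurable_envY_snd n :
  measurable_fun setT (fun z : 'rV[R]_d * env => envY (Y n z.2)).
Proof.
apply: (measurableT_comp mVY).
exact: (measurableT_comp (measurable_Y_env _) measurable_snd).
Qed.

Let goodC n r : ~` good n r = [set z | r < enorm z.1 ^+ 2] `|`
  [set z | r < envY (Y n%:Z z.2)].
Proof.
apply/seteqP; split => z /=; rewrite /good /=.
  by move=> /not_andP[|] /negP; rewrite -ltNge; [left|right].
by move=> [rz|rz] [] ; rewrite leNgt ?rz// => _; rewrite leNgt rz.
Qed.

Let measurable_good n r : measurable (good n r).
Proof.
rewrite -[good n r]setCK goodC; apply: measurableC; apply: measurableU;
  exact: measurable_gt.
Qed.

Let bound (theta0 : 'rV[R]_d) := enorm theta0 ^+ 2 + Cq / (lambda * Delta).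

Let state_law_bad k theta0 t n r : 0 < r ->
  (state_law k theta0 t (~` good n r) <= ((bound theta0 + My) / r)%:E)%E.
Proof.
move=> r0; rewrite goodC; apply: (le_trans (measureU2 _ _ _)).
- exact: measurable_gt.
- exact: measurable_gt.
rewrite mulrDl EFinD; apply: leeD.
  by apply: markov_tail => //; [move=> z; exact: sqr_ge0|exact: chain_moment].
apply: markov_tail => //.
rewrite (integral_env _ _ _ (c := fun w => envY (Y n%:Z w)))//.
  by rewrite integral_Y_stationary//; move: Y_moment; rewrite unlock.
by apply: (measurableT_comp mVY); exact: measurable_Y_env.
Qed.

(** On [good t r] the kernel is minorized, and [minorized_contraction] compares the two chains. The
    second moment bounds are uniform in time, so one [r], hence one [alpha], serves all [k], [t] and
    [u]. *)
Lemma contraction_step theta theta' (e : R) : 0 < e ->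
  exists alpha, [/\ 0 < alpha, alpha < 1 & forall (k t : nat) u,
    law_close (state_law 0 theta t) (state_law k%:Z theta' (k + t)) u ->
    law_close (state_law 0 theta t.+1) (state_law k%:Z theta' (k + t).+1)
      ((1 - alpha) * u + alpha * e)].
Proof.
(* By Markov's inequality the bad events of the two chains have total mass at most the sum of the
   bounds over [r]; this [r] is positive and makes the quotient at most [e]. *)
move=> e0; pose r := `|bound theta + My + (bound theta' + My)| / e + 1.
have r0 : 0 < r by rewrite ltr_wpDl// divr_ge0// ltW.
have [alpha [a0 a1 Ha]] := step_minorization r.
exists alpha; split => // k t u tu g mg g01.
have := integral_mean_step 0 theta t mg g01; rewrite !add0n => ->.
rewrite integral_mean_step//.
(* The average of [g] when the new state is uniform on the cube. It depends on [z] only through the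
   environment, so its means under the two joint laws agree by [integral_env]. *)
pose c (z : 'rV[R]_d * env) : R := \int[@uniform_cube R d]_v g (v, z.2).
have gv (w : env) : measurable_fun setT (fun v => g (v, w)).
  by apply: measurableT_comp => //; exact: measurable_fun_pair.
have cE z : (c z)%:E = (\int[@uniform_cube R d]_v (g (v, z.2))%:E)%E.
  rewrite /c /Rintegral fineK//; apply: integrable_fin_num => //.
  apply: (@bounded_integrable _ _ _ _ (fun v => g (v, z.2)) 1) => // v.
  by rewrite ger0_norm; case/andP: (g01 (v, z.2)).
have mcE : measurable_fun setT (fun z : 'rV[R]_d * env =>
    (\int[@uniform_cube R d]_v (g (v, z.2))%:E)%E).
  apply: (@measurable_fun_fubini_tonelli_F _ _ _ _ _ (@uniform_cube R d)
    (fun p : ('rV[R]_d * env) * 'rV[R]_d => (g (p.2, p.1.2))%:E)).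
    apply/measurable_EFinP; apply: measurableT_comp => //.
    apply: measurable_fun_pair => //.
    exact: (measurableT_comp measurable_snd).
  by move=> p; rewrite lee_fin; case/andP: (g01 (p.2, p.1.2)).
have mc : measurable_fun setT c.
  by apply/measurable_EFinP; rewrite -[_ \o _]/(fun z => (c z)%:E) (funext cE).
have ge z : measurable_fun setT (fun e => g (state_step 0 t (z, e))).
  apply: measurableT_comp => //.
  by apply: measurableT_comp; [exact: measurable_state_step|exact: measurable_fun_pair].
apply: (@minorized_contraction _ _ _ _ _ (good t r) _ c alpha u e) => //.
- exact: measurable_mean_step.
- by move=> z; exact: Rintegral01.
- by move=> z; exact: Rintegral01.
- move=> [x w] [/= xr yr].
  pose phi (e' : 'rV[R]_d) := step x (Y (t%:Z - 0) w) e'.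
  have mphi : measurable_fun setT phi.
    exact: (@measurable_step _ _ (cst x) id (cst (Y (t%:Z - 0) w))).
  have Hphi A : measurable A ->
      (alpha%:E * @uniform_cube R d A <= kappa (phi @^-1` A))%E.
    by move=> mA; apply: Ha => //; rewrite subr0.
  exact: (Rintegral_minorized (ltW a0) mphi Hphi (gv w) (fun v => g01 (v, w))).
- pose c' (w : env) := c (theta, w).
  have mc' : measurable_fun setT c'.
    by apply: measurableT_comp => //; exact: measurable_fun_pair.
  have c'0 w : 0 <= c' w.
    by have /andP[] :=
      Rintegral01 (@uniform_cube R d) (gv w) (fun v => g01 (v, w)).
  have EM (k' : int) th n : \int[state_law k' th n]_z c z = fine (\int[P]_w (c' w)%:E)%E.
    by rewrite -(integral_env k' th n mc' c'0).
  by rewrite !EM.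
- apply: (le_trans (leeD (state_law_bad _ _ _ _ r0) (state_law_bad _ _ _ _ r0))).
  rewrite -EFinD -mulrDl lee_fin ler_pdivrMr//.
  set X := bound _ + _ + _; rewrite /r -/X mulrDr mulr1 mulrCA mulfV ?gt_eqF// mulr1.
  by apply: (le_trans (ler_norm _)); rewrite lerDl ltW.
Qed.

(** The sequence [e + (1 - alpha) ^+ t] solves the recursion of [contraction_step]; its initial
    value [e + 1] exceeds the trivial bound one. *)
Lemma state_laws_merge theta theta' (e : R) : 0 < e ->
  exists alpha, [/\ 0 < alpha, alpha < 1 & forall k t : nat,
    law_close (state_law 0 theta t) (state_law k%:Z theta' (k + t))
      (e + (1 - alpha) ^+ t)].
Proof.
move=> e0; have [alpha [a0 a1 step_close]] := contraction_step theta theta' e0.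
exists alpha; split => // k; elim=> [|t IH].
  move=> g mg g01; rewrite expr0.
  have dist01 (x y : R) : 0 <= x <= 1 -> 0 <= y <= 1 -> `|x - y| <= e + 1.
    by rewrite ler_norml; lra.
  by apply: dist01; exact: Rintegral01.
rewrite addnS exprS (_ : e + _ = (1 - alpha) * (e + (1 - alpha) ^+ t) + alpha * e).
  exact: step_close.
by ring.
Qed.

(** * Convergence of the laws of the state *)

Lemma measurable_chain_preimage k theta n A : measurable A ->
  measurable (chain k theta n @^-1` A).
Proof. by apply: measurable_preimageT; exact: measurable_chain. Qed.

Let Rintegral_indic_fst k theta n (A : set 'rV[R]_d) : measurable A ->
  \int[state_law k theta n]_z \1_A z.1 = fine (P (chain k theta n @^-1` A)).
Proof.
move=> mA; rewrite /Rintegral ge0_integral_distribution//.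
  congr fine; transitivity (\int[P]_w (\1_(chain k theta n @^-1` A) w)%:E)%E.
    exact: eq_integral.
  by rewrite integral_indic ?setIT//; exact: measurable_chain_preimage.
by apply/measurable_EFinP; apply: measurableT_comp => //; exact: measurable_indic.
Qed.

Lemma chain_law_shift k theta n (A : set 'rV[R]_d) : measurable A ->
  P (chain k theta n @^-1` A) = P (chain 0 theta n @^-1` A).
Proof.
move=> mA; rewrite -[LHS]fineK ?fin_num_measure//; last exact: measurable_chain_preimage.
rewrite -[RHS]fineK ?fin_num_measure//; last exact: measurable_chain_preimage.
rewrite -!Rintegral_indic_fst// /Rintegral.
(* The empty family of times: only the state component is observed. *)
pose t (i : 'I_0) : int := 0.
congr (fine _)%:E.
apply: (@chain_shift_invariant k theta n 0 t (fun p => (\1_A p.1)%:E)).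
  by apply/measurable_EFinP; apply: measurableT_comp => //; exact: measurable_indic.
by move=> z; rewrite lee_fin.
Qed.

(** The second chain is started [s] steps earlier, so that both share the environment at the same
    times; [chain_law_shift] then moves its start back to time 0. The rate depends neither on [s]
    nor on [A]. *)
Lemma chain_laws_merge theta theta' (e : R) : 0 < e -> exists N : nat,
  forall t s A, (N <= t)%N -> measurable A ->
  `|fine (P (chain 0 theta t @^-1` A)) - fine (P (chain 0 theta' (t + s) @^-1` A))| <= e.
Proof.
move=> e0; have e2 : 0 < e / 2 by rewrite divr_gt0.
have [alpha [a0 a1 merge]] := state_laws_merge theta theta' e2.
have : (1 - alpha) ^+ t @[t --> \oo] --> (0 : R).
  by apply: cvg_expr; rewrite ger0_norm; lra.
move=> /cvgrPdist_le/(_ _ e2)[N _ HN]; exists N => t s A Nt mA.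
have := HN t Nt; rewrite /= sub0r normrN => HNt.
have mA' : measurable_fun setT (fun z : 'rV[R]_d * env => \1_A z.1 : R).
  by apply: measurableT_comp => //; exact: measurable_indic.
have A01 (z : 'rV[R]_d * env) : 0 <= (\1_A z.1 : R) <= 1.
  by rewrite indicE; case: (_ \in _); rewrite ?lexx ?ler01.
have := merge s t _ mA' A01; rewrite !Rintegral_indic_fst// chain_law_shift// addnC.
move=> /le_trans; apply; rewrite [leRHS]splitr lerD2l.
by apply: le_trans HNt; rewrite ler_norm.
Qed.

(** Merging a chain with its own time shifts gives the Cauchy property, here for the chain started
    at 0. Merging at equal times, [s = 0], carries the limit over to every other starting point. *)
Lemma chain_laws_converge : exists mu : probability 'rV[R]_d R,
  forall theta (e : R), 0 < e -> exists N : nat, forall t A, (N <= t)%N ->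
    measurable A -> (`|P (chain 0 theta t @^-1` A) - mu A| <= e%:E)%E.
Proof.
pose chainRV t : {RV P >-> 'rV[R]_d} :=
  HB.pack (chain 0 0 t) (isMeasurableFun.Build _ _ _ _ _ (measurable_chain 0 0 t)).
have [mu Hmu] := @uniform_limit_probability _ _ R (fun t => distribution P (chainRV t))
  (fun e e0 => chain_laws_merge 0 0 e0).
exists mu => theta e e0; have e2 : 0 < e / 2 by rewrite divr_gt0.
have [N HN] := chain_laws_merge theta 0 e2; have [N' HN'] := Hmu _ e2.
exists (maxn N N') => t A; rewrite geq_max => /andP[Nt N't] mA.
have mcA := measurable_chain_preimage 0 theta t mA.
rewrite -(fineK (fin_num_measure P _ mcA)) -(fineK (fin_num_measure mu _ mA)).
rewrite -EFinB abse_EFin lee_fin.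
have := HN t 0%N A Nt mA; have := HN' t A N't mA; rewrite addn0.
rewrite /= /distribution /pushforward /= !ler_norml; lra.
Qed.

End chain.

(** * Choice of [lambda0] and convergence of [tv_dist] *)

Theorem theorem2p1 (R : realType) (d m : nat) (d_ge1 : (1 <= d)%N)
    (m_ge1 : (1 <= m)%N)
    (disp : measure_display) (Omega : measurableType disp)
    (P : probability Omega R)
    (xi : nat -> {RV P >-> 'rV[R]_d}) (sigma : R) (f : 'rV[R]_d -> R)
    (xi_indep : mutually_independent P [set i | (1 <= i)%N] xi)
    (xi_ident : identically_distributed P [set i | (1 <= i)%N] xi)
    (xi_coord : forall i : nat, (1 <= i)%N ->
      mutually_independent P setT (fun (k : 'I_d) w => xi i w ord0 k))
    (xi_mean : forall i : nat, (1 <= i)%N ->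
      forall k : 'I_d, ('E_P[(fun w => xi i w ord0 k)%R] = 0)%E)
    (xi_var : forall i : nat, (1 <= i)%N ->
      ('E_P[(fun w => enorm (xi i w) ^+ 2)%R] = (sigma ^+ 2)%:E)%E)
    (xi_density : forall i : nat, (1 <= i)%N ->
      has_density P (xi i) (lebesgue_rV R d) f)
    (f_inf : forall K : set 'rV[R]_d, compact K ->
      (0 < ereal_inf [set (f x)%:E | x in K])%E)
    (Y : int -> {RV P >-> 'rV[R]_m})
    (Y_stationary : strictly_stationary P Y)
    (Y_xi_indep : independent_systems P (sigma_generated setT Y)
      (sigma_generated [set i | (1 <= i)%N] xi))
    (H : 'rV[R]_d * 'rV[R]_m -> 'rV[R]_d)
    (H_meas : measurable_fun setT H)
    (Delta : R) (b : 'rV[R]_m -> R)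
    (Delta_gt0 : 0 < Delta)
    (b_meas : measurable_fun setT b) (b_ge0 : forall y, 0 <= b y)
    (H_dissip : forall (th : 'rV[R]_d) (y : 'rV[R]_m),
      Delta * enorm th ^+ 2 - b y <= dotp (H (th, y)) th)
    (K1 K2 K3 beta : R)
    (K1_gt0 : 0 < K1) (K2_gt0 : 0 < K2) (K3_gt0 : 0 < K3) (beta_ge1 : 1 <= beta)
    (H_growth : forall (th : 'rV[R]_d) (y : 'rV[R]_m),
      enorm (H (th, y)) <= K1 * enorm th + K2 * enorm y `^ beta + K3)
    (My Mb : R) (My_gt0 : 0 < My) (Mb_gt0 : 0 < Mb)
    (Y_moment : ('E_P[(fun w => enorm (Y 0 w) `^ (2 * beta))%R] <= My%:E)%E)
    (b_moment : ('E_P[(fun w => b (Y 0 w))%R] <= Mb%:E)%E) :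
  exists lambda0 : R, [/\ 0 < lambda0, lambda0 <= 1 &
    forall lambda : R, 0 < lambda -> lambda < lambda0 ->
      exists mu : probability 'rV[R]_d R,
        forall theta0 : 'rV[R]_d,
          tv_dist (pushforward P (theta_process H xi Y lambda theta0 t)) mu
            @[t --> \oo] --> 0%E].
Proof.
have K1sq : 0 < 3 * K1 ^+ 2 by rewrite mulr_gt0// exprn_gt0.
(* The bound [Delta^-1] gives [lambda * Delta <= 1], and the last one lets the dissipation absorb
   the quadratic growth of [H]. *)
exists (Num.min 1 (Num.min Delta^-1 (Delta / (3 * K1 ^+ 2)))); split.
- by rewrite !lt_min ltr01 invr_gt0 Delta_gt0 divr_gt0.
- by rewrite ge_min lexx.
move=> lambda l0; rewrite !lt_min => /and3P[_ lD lK].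
have lDelta : lambda * Delta <= 1 by rewrite -ler_pdivlMr// div1r ltW.
have lK1 : 3 * K1 ^+ 2 * lambda <= Delta by rewrite mulrC -ler_pdivlMr// ltW.
have [mu Hmu] := chain_laws_converge xi_indep xi_ident Y_stationary Y_xi_indep
  H_meas (xi_mean 1 isT) (xi_var 1 isT) b_meas b_ge0 H_dissip H_growth Y_moment
  b_moment Delta_gt0 l0 lDelta lK1 (xi_density 1 isT) f_inf.
exists mu => theta0.
have chainE t : theta_process H xi Y lambda theta0 t = chain xi Y H lambda 0 theta0 t.
  by rewrite /chain; congr (theta_process _ _ _ _ _ _); apply/funext => i; rewrite subr0.
(* The threshold [N] is uniform over measurable sets, so the bound passes to the supremum. *)
have tv_le e : 0 < e -> exists N : nat, forall t, (N <= t)%N ->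
    (0 <= tv_dist (pushforward P (theta_process H xi Y lambda theta0 t)) mu <= e%:E)%E.
  move=> e0; have [N HN] := Hmu theta0 e e0; exists N => t Nt; apply/andP; split.
    apply: (le_trans (abse_ge0 (pushforward P (theta_process H xi Y lambda theta0 t)
      set0 - mu set0))).
    by apply: ereal_sup_ubound; exists set0.
  apply: ge_ereal_sup => _ [A mA <-]; rewrite chainE; exact: HN.
apply/fine_cvgP; split.
  have [N HN] := tv_le 1 ltr01; exists N => // t /= /HN /andP[t0 t1].
  by rewrite ge0_fin_numE// (le_lt_trans t1)// ltry.
apply/cvgrPdist_le => e e0; have [N HN] := tv_le e e0.
exists N => // t /= /HN /andP[t0 te].
rewrite sub0r normrN ger0_norm ?fine_ge0// -lee_fin fineK//.
by rewrite ge0_fin_numE// (le_lt_trans te)// ltry.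
Qed.
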